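(* Let $N$ be a finitely generated, semipositive, cancellative, reduced binoid and let $\mathfrak n$ be an $N_+$-primary ideal of $N$. Then the Hilbert–Kunz multiplicity $e_{HK}(\mathfrak n,N)=\lim_{q\to\infty}\operatorname{HKF}(\mathfrak n,N,q)/q^{\dim N}$ exists and is a rational number.
   Context: A binoid $(N,+,0,\infty)$ is a commutative monoid $(N,+,0)$ with an element $\infty$ satisfying $a+\infty=\infty$ for all $a\in N$. Write $N^\bullet=N\setminus\{\infty\}$, $N^\times$ for the group of units of $N$ and $N_+=N\setminus N^\times$. $N$ is finitely generated if it is finitely generated as a monoid; semipositive if $N\neq\{\infty\}$ and $N^\times$ is finite; positive if $N\neq\{\infty\}$ and $N^\times=\{0\}$. An ideal of $N$ is a nonempty subset $I\subseteq N$ with $I+N\subseteq I$ (so $\infty\in I$). For an ideal $I$ and $q\in\mathbb N_+$, $[q]I$ denotes the ideal generated by $\{qa: a\in I\}$. An ideal $\mathfrak n$ is $N_+$-primary if $\mathfrak n\subseteq N_+$ and for every $a\in N_+$ there is $k\ge1$ with $ka\in\mathfrak n$. The residue class binoid $N/I$ is $(N\setminus I)\cup\{\infty\}$, with $[a]+[b]=[a+b]$ if $a+b\notin I$ and $=\infty$ otherwise. A prime ideal is an ideal $\mathfrak p\neq N$ such that $a+b\in\mathfrak p$ implies $a\in\mathfrak p$ or $b\in\mathfrak p$; the (combinatorial) dimension $\dim N$ is the supremum of the lengths $k$ of chains $\mathfrak p_0\subsetneq\cdots\subsetneq\mathfrak p_k$ of prime ideals. An element $a$ is nilpotent if $ka=\infty$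 for some $k\ge1$; $N$ is reduced if $\infty$ is its only nilpotent element. $N$ is integral if $N\neq\{\infty\}$ and $a+b=\infty$ implies $a=\infty$ or $b=\infty$. $N$ is cancellative if $a+b=a+c\neq\infty$ implies $b=c$. $N$ is torsion-free if $ka=kb$ with $k\ge1$ implies $a=b$, and torsion-free up to nilpotence if $ka=kb\neq\infty$ with $k\ge1$ implies $a=b$. An $N$-set is a pointed set $(S,p)$ with a map $N\times S\to S$, $(n,s)\mapsto n+s$, such that $(n+m)+s=n+(m+s)$, $0+s=s$, $\infty+s=p$ and $n+p=p$. It is finitely generated if there are $s_1,\dots,s_r\in S$ with $S=\bigcup_j (N+s_j)$. $N$ itself and $N/I$ are $N$-sets with distinguished point $\infty$. For an ideal $J$ and an $N$-set $T$, $J+T=\{a+t:a\in J,t\in T\}$ is an $N$-subset; for an $N$-subset $S\subseteq T$ (a subset containing $p$ and stable under the action), the quotient $T/S$ is the $N$-set $(T\setminus S)\cup\{p\}$ (with $S$ collapsed to the point). For a finite pointed set $S$ we write $\#S=|S|-1$. For $N$ finitely generated and semipositive, $T$ a finitely generated $N$-set, $\mathfrak n$ an $N_+$-primary ideal and $q\in\mathbb N_+$, the Hilbert–Kunz function is $\operatorname{HKF}(\mathfrak n,T,q)=\#\,T/([q]\mathfrak n+T)$ (this set is finite), and $\operatorname{HKF}(N,q):=\operatorname{HKF}(N_+,N,q)=\#N/[q]N_+$. The Hilbert–Kunz multiplicity is $e_{HK}(\mathfrak n,T)=\lim_{q\to\infty}\operatorname{HKF}(\mathfrak n,T,q)/q^{\dim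 N}$, the limit taken over all positive integers $q$, when it exists; $e_{HK}(N):=e_{HK}(N_+,N)$. *)

(* Defs.v *)
From HB Require Import structures.
From mathcomp Require Import all_boot all_order all_algebra.
From Stdlib Require Import List.
Set Implicit Arguments. Unset Strict Implicit. Unset Printing Implicit Defensive.

Record binoid := Binoid {
  bcar :> Type;
  badd : bcar -> bcar -> bcar;
  bzero : bcar;
  binf : bcar;
  baddA : forall a b c, badd a (badd b c) = badd (badd a b) c;
  baddC : forall a b, badd a b = badd b a;
  badd0 : forall a, badd bzero a = a;
  baddI : forall a, badd a binf = binf
}.

Section BinoidDefs.
Variable N : binoid.
Local Notation "a +b b" := (badd a b) (at level 50, left associativity).

Fixpoint bnsmul (k : nat) (a : N) : N :=
  match k with O => bzero N | S k' => a +b bnsmul k' a end.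

Inductive gen_by (G : list N) : N -> Prop :=
| gen_zero : gen_by G (bzero N)
| gen_add g x : List.In g G -> gen_by G x -> gen_by G (g +b x).

Definition finitely_generated : Prop :=
  exists G : list N, forall x : N, gen_by G x.

Definition is_unit (a : N) : Prop := exists b, a +b b = bzero N.

Definition Nplus (a : N) : Prop := ~ is_unit a.

Definition semipositive : Prop :=
  (exists x : N, x <> binf N) /\
  (exists l : list N, forall a, is_unit a -> List.In a l).

Definition cancellative : Prop :=
  forall a b c : N, a +b b = a +b c -> a +b b <> binf N -> b = c.

Definition nilpotent (a : N) : Prop :=
  exists k, (1 <= k)%N /\ bnsmul k a = binf N.

Definition reduced : Prop := forall a : N, nilpotent a -> a = binf N.

Definition ideal (I : N -> Prop) : Prop :=
  (exists x, I x) /\ (forall a n, I a -> I (a +b n)).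

Definition prime_ideal (P : N -> Prop) : Prop :=
  ideal P /\ (exists x, ~ P x) /\ (forall a b, P (a +b b) -> P a \/ P b).

Definition strict_subset (A B : N -> Prop) : Prop :=
  (forall x, A x -> B x) /\ (exists x, B x /\ ~ A x).

Definition prime_chain (k : nat) (p : nat -> N -> Prop) : Prop :=
  (forall i, (i <= k)%N -> prime_ideal (p i)) /\
  (forall i, (i < k)%N -> strict_subset (p i) (p i.+1)).

Definition is_dim (d : nat) : Prop :=
  (exists p, prime_chain d p) /\
  (forall k p, prime_chain k p -> (k <= d)%N).

Definition Nplus_primary (n : N -> Prop) : Prop :=
  ideal n /\ (forall a, n a -> Nplus a) /\
  (forall a, Nplus a -> exists k, (1 <= k)%N /\ n (bnsmul k a)).

Definition qideal (q : nat) (I : N -> Prop) (x : N) : Prop :=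
  exists a b, I a /\ x = bnsmul q a +b b.

Definition sumset (J : N -> Prop) (x : N) : Prop :=
  exists a t, J a /\ x = a +b t.

Definition card_is (P : N -> Prop) (k : nat) : Prop :=
  exists l : list N, List.NoDup l /\ (forall x, P x <-> List.In x l) /\ length l = k.

(* HKF(n, N, q) = k : #N/([q]n + N) = k, i.e. |N \ ([q]n + N)| = k
   (the distinguished point oo lies in [q]n + N and is not counted by #). *)
Definition HKF_is (n : N -> Prop) (q k : nat) : Prop :=
  card_is (fun x => ~ sumset (qideal q n) x) k.

End BinoidDefs.

(* Main.v *)
Require Import Defs.
From HB Require Import structures.
From mathcomp Require Import all_boot all_order all_algebra.
From mathcomp Require Import boolp.
From mathcomp Require Import zify ring lra.
Import Order.TTheory GRing.Theory Num.Theory.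
Set Implicit Arguments. Unset Strict Implicit. Unset Printing Implicit Defensive.

(* The function k(q) = #(N \ [q]n) is eventually a quasi-polynomial.  Indeed the
   pairs (x, q) with x outside [q]n lie in a monoid generated by finitely many elements
   (y, 1), and the condition x \in q a + N cuts out of a finitely generated submonoid
   of N * nat another one, by Dickson's lemma and cancellativity; an inclusion-exclusion
   over generators a of n reduces to Hilbert functions of such submonoids.  Since
   [q + 1]n is contained in [q]n, k is nondecreasing; so as soon as k(q) = O(q ^ d) its
   leading coefficient does not depend on the residue class of q, which gives a rational
   limit.  The bound comes from saturated chains of faces x_1, ..., x_l of N: each step
   has rank one, so that up to bounded torsion an element is determined by l integer
   coordinates, and the complements of the faces form a chain of primes,
   whence l <= dim N. *)

Local Open Scope ring_scope.

(** The binoid may be neither integral nor torsion-free, so it need not sit in a lattice where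
    points of a polytope could be counted. What survives is subtraction below a finite sum, enough
    for Dickson's lemma to yield finite generating sets; torsion and units are absorbed by
    multiplying by a fixed exponent. The generators (y, 1) come from a constant B such that for each
    generator g of N the multiple B g is 0 or lies in n: an x outside [q]n then has coefficients at
    most B q, hence is a sum of q elements with coefficients at most B. Intersecting with the
    condition x in q a + N creates generators of higher degree, and these degrees are the source of
    the periods. Reducedness acts twice: multiples of finite elements stay finite, so relations can
    be multiplied and then cancelled, and the face of a finite element misses infinity, so its
    complement is prime. Growth is bounded from above only; the limit exists whatever the exact
    degree. *)

(** * Dickson's lemma and sets closed under subtraction *)

Lemma dickson (m : nat) (U : (nat -> nat) -> Prop) :
  exists l : seq (nat -> nat), (forall v, v \in l -> U v) /\
    forall u, U u -> exists2 v, v \in l & forall i, (i < m)%N -> (v i <= u i)%N.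
Proof.
elim: m U => [|m IHm] U.
  have [[u Uu]|nU] := pselect (exists u, U u); last first.
    by exists [::]; split=> // u Uu; case: nU; exists u.
  exists [:: u]; split=> [v|u' _]; first by rewrite inE => /eqP->.
  by exists u => //; rewrite inE.
have [l [Ul domin]] := IHm U.
(* Vectors of [U] with last coordinate at least [B] dominate an element of [l];
   the others lie in finitely many slices. *)
pose B := (\max_(v <- l) v m)%N.
have leB v : v \in l -> (v m <= B)%N by move=> vl; rewrite /B (big_rem v) //= leq_maxl.
have [l' [Ul' domin']] : exists l' : seq (nat -> nat), (forall v, v \in l' -> U v) /\
    forall u, U u -> (u m < B)%N -> exists2 v, v \in l' &
      forall i, (i < m.+1)%N -> (v i <= u i)%N.
  elim: B {leB} => [|B [l' [Ul' domin']]]; first by exists [::].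
  have [l2 [Ul2 domin2]] := IHm (fun u => U u /\ u m = B).
  exists (l' ++ l2); split=> [v|u Uu].
    by rewrite mem_cat => /orP[/Ul'|/Ul2[]].
  rewrite ltnS leq_eqVlt => /orP[/eqP uB|/(domin' _ Uu)[v vl' vu]].
    have [v vl2 vu] := domin2 u (conj Uu uB).
    exists v; first by rewrite mem_cat vl2 orbT.
    move=> i.
    rewrite ltnS leq_eqVlt => /orP[/eqP->|/vu//].
    by have [_ ->] := Ul2 _ vl2; rewrite uB.
  by exists v => //; rewrite mem_cat vl'.
exists (l ++ l'); split=> [v|u Uu].
  by rewrite mem_cat => /orP[/Ul|/Ul'].
have [uB|Bu] := ltnP (u m) B.
  have [v vl' vu] := domin' _ Uu uB.
  by exists v => //; rewrite mem_cat vl' orbT.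
have [v vl vu] := domin _ Uu.
exists v => [|i]; first by rewrite mem_cat vl.
rewrite ltnS leq_eqVlt => /orP[/eqP->|/vu//].
exact: leq_trans (leB _ vl) Bu.
Qed.

(* Solution sets of linear equations over a cancellative binoid are closed
   under subtraction only as long as the common value is finite; hence the two
   predicates [Q] (finite value) and [P]. *)
Lemma subtractive_ind (m : nat) (P Q : (nat -> nat) -> Prop) :
  (forall u, Q u -> P u) ->
  (forall u v, Q u -> P v -> (forall i, (i < m)%N -> (v i <= u i)%N) ->
     Q (fun i => u i - v i)%N) ->
  exists H : seq (nat -> nat), (forall v, v \in H -> P v) /\
    forall R : (nat -> nat) -> Prop,
      (forall u, (forall i, (i < m)%N -> u i = 0%N) -> R u) ->
      (forall u v, Q u -> v \in H -> (forall i, (i < m)%N -> (v i <= u i)%N) ->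
         R (fun i => u i - v i)%N -> R u) ->
      forall u, Q u -> R u.
Proof.
move=> QP Qsub.
(* Every nonzero vector of [P] dominates a vector of [H]; subtracting the latter lowers the
   coordinate sum. *)
have [H [UH domin]] := dickson m (fun u => P u /\ (0 < \sum_(i < m) u i)%N).
exists H; split=> [v /UH[]//|R R0 RS u].
have [s] := ubnP (\sum_(i < m) u i)%N; elim: s u => // s IHs u us Qu.
have [s0|spos] := posnP (\sum_(i < m) u i)%N.
  apply: R0 => i im; apply/eqP.
  by move/eqP: s0; rewrite sum_nat_eq0 => /forallP/(_ (Ordinal im)).
have [v vH vu] := domin u (conj (QP _ Qu) spos).
have [Pv vpos] := UH _ vH.
apply: (RS u v) => //; apply: IHs; last exact: Qsub.
rewrite -ltnS; apply: leq_trans us; rewrite ltnS.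
have -> : (\sum_(i < m) u i = \sum_(i < m) (u i - v i) + \sum_(i < m) v i)%N.
  by rewrite -big_split /=; apply: eq_bigr => i _; rewrite subnK // vu.
by rewrite -addn1 leq_add2l.
Qed.

(** * Linear combinations and spans *)

(** Coefficients are functions on all of [nat], of which the first [size ys] values count; blocks of
    coordinates can then be shifted and joined without casts. *)
Definition lin (V : nmodType) (ys : seq V) (e : nat -> nat) : V :=
  \sum_(i < size ys) ys`_i *+ e i.

Section Lin.
Variable V : nmodType.
Implicit Types (ys zs : seq V) (e : nat -> nat).

Lemma lin_nil e : lin ([::] : seq V) e = 0.
Proof. exact: big_ord0. Qed.

Lemma lin_cons y ys e : lin (y :: ys) e = y *+ e 0%N + lin ys (fun i => e i.+1).
Proof. exact: big_ord_recl. Qed.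

Lemma eq_lin ys e e' : (forall i, (i < size ys)%N -> e i = e' i) ->
  lin ys e = lin ys e'.
Proof. by move=> ee'; apply: eq_bigr => i _; rewrite ee'. Qed.

Lemma linD ys e e' : lin ys (fun i => e i + e' i)%N = lin ys e + lin ys e'.
Proof. by rewrite -big_split; apply: eq_bigr => i _; rewrite mulrnDr. Qed.

Lemma linMn ys e k : lin ys (fun i => e i * k)%N = lin ys e *+ k.
Proof. by rewrite -sumrMnl; apply: eq_bigr => i _; rewrite mulrnA. Qed.

Lemma lin0 ys e : (forall i, (i < size ys)%N -> e i = 0%N) -> lin ys e = 0.
Proof. by move=> e0; apply: big1 => i _; rewrite e0. Qed.

Lemma lin_delta ys i : (i < size ys)%N -> lin ys (fun j => j == i) = ys`_i.
Proof.
move=> iys; rewrite /lin (bigD1 (Ordinal iys)) //= eqxx big1 ?addr0 // => j ji.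
by rewrite -val_eqE /= in ji; rewrite (negbTE ji).
Qed.

Lemma lin_subK ys e e' : (forall i, (i < size ys)%N -> (e' i <= e i)%N) ->
  lin ys e = lin ys e' + lin ys (fun i => e i - e' i)%N.
Proof. by move=> e'e; rewrite -linD; apply: eq_lin => i iys; rewrite subnKC ?e'e. Qed.

End Lin.

Definition span (V : nmodType) (ys : seq V) (z : V) : Prop := exists e, z = lin ys e.

Section Span.
Variable V : nmodType.
Implicit Types ys : seq V.

Lemma span0 ys : span ys 0.
Proof. by exists (fun=> 0%N); rewrite lin0. Qed.

Lemma spanD ys y z : span ys y -> span ys z -> span ys (y + z).
Proof. by move=> [e ->] [e' ->]; eexists; rewrite -linD. Qed.

Lemma spanMn ys y k : span ys y -> span ys (y *+ k).
Proof. by move=> [e ->]; eexists; rewrite -linMn. Qed.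

Lemma span_mem ys y : y \in ys -> span ys y.
Proof.
by move=> yys; exists (fun j => j == index y ys); rewrite lin_delta ?nth_index ?index_mem.
Qed.

Lemma span_cons y ys z :
  span (y :: ys) z <-> exists k t, span ys t /\ z = y *+ k + t.
Proof.
split=> [[e ->]|[k [t [[e ->] ->]]]].
  by exists (e 0%N), (lin ys (fun i => e i.+1)); split; [eexists|rewrite lin_cons].
by exists (fun i => if i is i'.+1 then e i' else k); rewrite lin_cons.
Qed.

Lemma span_nil z : span ([::] : seq V) z <-> z = 0.
Proof. by split=> [[e ->]|->]; [rewrite lin_nil | apply: span0]. Qed.

Lemma span_consr y ys z : span ys z -> span (y :: ys) z.
Proof. by move=> zys; apply/span_cons; exists 0%N, z; rewrite mulr0n add0r. Qed.

End Span.

(** * Eventual quasi-polynomials *)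

Definition fdiff (w : nat) (f : nat -> rat) (q : nat) : rat := f (q + w)%N - f q.

Definition fdiffs (ws : seq nat) (f : nat -> rat) : nat -> rat := foldr fdiff f ws.

(** Being killed for large q by a product of operators f(q + w) - f(q) means that the generating
    function is rational with denominator a product of factors 1 - t^w. In this form closure under
    differences and under solving [fdiff w f = g] is immediate. *)
Definition quasi_poly (f : nat -> rat) : Prop :=
  exists2 ws, all (leq 1) ws & exists Q, forall q, (Q <= q)%N -> fdiffs ws f q = 0.

Section QuasiPoly.
Implicit Types (f g : nat -> rat) (ws vs : seq nat).

Lemma fdiffC v w f : fdiff v (fdiff w f) = fdiff w (fdiff v f).
Proof. by apply/funext => q; rewrite /fdiff addnAC; ring. Qed.

Lemma fdiffs_fdiff ws w f : fdiffs ws (fdiff w f) = fdiff w (fdiffs ws f).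
Proof. by elim: ws => //= v ws ->; rewrite fdiffC. Qed.

Lemma fdiffsC ws vs f : fdiffs ws (fdiffs vs f) = fdiffs vs (fdiffs ws f).
Proof. by elim: vs => //= v vs <-; rewrite fdiffs_fdiff. Qed.

Lemma fdiffsB ws f g :
  fdiffs ws (fun q => f q - g q) = fun q => fdiffs ws f q - fdiffs ws g q.
Proof. by elim: ws => //= w ws ->; apply/funext => q; rewrite /fdiff; ring. Qed.

Lemma fdiffs_shift ws f w :
  fdiffs ws (fun q => f (q + w)%N) = fun q => fdiffs ws f (q + w)%N.
Proof. by elim: ws => //= v ws ->; apply/funext => q; rewrite /fdiff addnAC. Qed.

Lemma eq_fdiffs ws f g Q : (forall q, (Q <= q)%N -> f q = g q) ->
  forall q, (Q <= q)%N -> fdiffs ws f q = fdiffs ws g q.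
Proof.
move=> fg; elim: ws => [|w ws IHws] q Qq /=; first exact: fg.
by rewrite /fdiff !IHws // (leq_trans Qq) ?leq_addr.
Qed.

Lemma fdiffs0 ws Q f : (forall q, (Q <= q)%N -> f q = 0) ->
  forall q, (Q <= q)%N -> fdiffs ws f q = 0.
Proof.
move=> f0; elim: ws => [|w ws IHws] q Qq /=; first exact: f0.
by rewrite /fdiff !IHws ?subrr // (leq_trans Qq) ?leq_addr.
Qed.

Lemma quasi_poly_eq f g Q : (forall q, (Q <= q)%N -> f q = g q) ->
  quasi_poly f -> quasi_poly g.
Proof.
move=> fg [ws ws0 [Q' f0]]; exists ws => //; exists (maxn Q Q') => q.
by rewrite geq_max => /andP[Qq Q'q]; rewrite -(eq_fdiffs ws fg) ?f0.
Qed.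

Lemma quasi_poly0 Q f : (forall q, (Q <= q)%N -> f q = 0) -> quasi_poly f.
Proof. by move=> f0; exists [::] => //; exists Q. Qed.

Lemma quasi_polyB f g :
  quasi_poly f -> quasi_poly g -> quasi_poly (fun q => f q - g q).
Proof.
move=> [ws ws0 [Q f0]] [vs vs0 [Q' g0]].
exists (ws ++ vs); first by rewrite all_cat ws0.
exists (maxn Q Q') => q; rewrite geq_max => /andP[Qq Q'q].
rewrite fdiffsB /fdiffs !foldr_cat -!/(fdiffs _ _) fdiffsC.
by rewrite (fdiffs0 vs f0) // (fdiffs0 ws g0) // subrr.
Qed.

Lemma quasi_polyD f g :
  quasi_poly f -> quasi_poly g -> quasi_poly (fun q => f q + g q).
Proof.
move=> qf qg; apply: (@quasi_poly_eq (fun q => f q - ((0 - g q))) _ 0).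
  by move=> q _; ring.
by apply: quasi_polyB => //; apply: quasi_polyB => //; apply: (@quasi_poly0 0).
Qed.

Lemma quasi_poly_shift f w : quasi_poly (fun q => f (q + w)%N) <-> quasi_poly f.
Proof.
split=> -[ws ws0 [Q f0]]; exists ws => //.
  exists (Q + w)%N => q Qq; have wq : (w <= q)%N by apply: leq_trans Qq; apply: leq_addl.
  by have := f0 (q - w)%N; rewrite fdiffs_shift subnK //; apply; rewrite leq_subRL // addnC.
by exists Q => q Qq; rewrite fdiffs_shift f0 // (leq_trans Qq) ?leq_addr.
Qed.

Lemma quasi_poly_fdiff f w : (0 < w)%N -> quasi_poly (fdiff w f) -> quasi_poly f.
Proof.
move=> w0 [ws ws0 [Q f0]]; exists (w :: ws); first by rewrite /= w0.
by exists Q => q Qq /=; rewrite -fdiffs_fdiff f0.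
Qed.

(** If w divides p, a difference of step p is a sum of shifted differences of step w; so all steps
    can be replaced by one common multiple, here their product. *)
Lemma quasi_poly_period f : quasi_poly f ->
  exists p n Q, (0 < p)%N /\ forall q, (Q <= q)%N -> fdiffs (nseq n p) f q = 0.
Proof.
move=> [ws ws0 [Q f0]].
have [p p0 pws] : exists2 p, (0 < p)%N & all (fun w => w %| p)%N ws.
  elim: ws ws0 {f0} => [|w ws IHws] /=; first by exists 1%N.
  move=> /andP[w0 /IHws[p p0 pws]]; exists (w * p)%N; first by rewrite muln_gt0 w0.
  by rewrite dvdn_mulr //=; apply: sub_all pws => v; apply: dvdn_mull.
exists p, (size ws), Q; split=> // q Qq.
elim: ws f f0 pws {ws0} q Qq => [|w ws IHws] f f0 /= => [_ q Qq|]; first exact: f0.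
move=> /andP[/dvdnP[m pE] pws] q Qq.
rewrite -fdiffs_fdiff; apply: IHws => // {}q {}Qq; rewrite fdiffs_fdiff.
apply/eqP; rewrite subr_eq0 pE; apply/eqP; elim: m {pE} => [|m IHm].
  by rewrite mul0n addn0.
have /eqP := f0 (q + m * w)%N (leq_trans Qq (leq_addr _ _)).
by rewrite /= subr_eq0 -addnA -mulSnr IHm => /eqP.
Qed.

Lemma newton n f : (forall j, fdiffs (nseq n 1%N) f j = 0) ->
  exists a : nat -> rat, forall j, f j = \sum_(i < n) 'C(j, i)%:R * a i.
Proof.
elim: n f => [|n IHn] f f0 /=.
  by exists (fun=> 0) => j; rewrite big_ord0; apply: f0.
have [a fa] : exists a : nat -> rat, forall j, fdiff 1 f j = \sum_(i < n) 'C(j, i)%:R * a i.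
  by apply: IHn => j; rewrite fdiffs_fdiff; apply: f0.
exists (fun i => if i is i'.+1 then a i' else f 0%N) => j.
rewrite big_ord_recl bin0 mul1r /=; elim: j => [|j IHj].
  by rewrite big1 ?addr0 // => i _; rewrite bin_small ?mul0r.
have /eqP := fa j; rewrite /fdiff addn1 subr_eq => /eqP ->; rewrite {}IHj.
rewrite addrCA -big_split; congr (_ + _); apply: eq_bigr => i _ /=.
by rewrite /bump /= add1n binS natrD; ring.
Qed.

End QuasiPoly.

(** * Limits of rational sequences *)

Definition tends (u : nat -> rat) (l : rat) : Prop :=
  forall eps, 0 < eps -> exists Q, forall q, (Q <= q)%N -> `|u q - l| < eps.

Section Tends.
Implicit Types u v : nat -> rat.

Lemma tends_eq u v l Q : (forall q, (Q <= q)%N -> u q = v q) -> tends u l -> tends v l.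
Proof.
move=> uv ul e /ul[Q' le]; exists (maxn Q Q') => q; rewrite geq_max => /andP[Qq Q'q].
by rewrite -uv ?le.
Qed.

Lemma tends_cst l : tends (fun=> l) l.
Proof. by move=> e e0; exists 0%N => q _; rewrite subrr normr0. Qed.

Lemma tendsD u v l m : tends u l -> tends v m -> tends (fun q => u q + v q) (l + m).
Proof.
move=> ul vm e e0; have e2 : 0 < e / 2%:R by rewrite divr_gt0.
have [Q lu] := ul _ e2; have [Q' mv] := vm _ e2.
exists (maxn Q Q') => q; rewrite geq_max => /andP[/lu {}lu /mv {}mv].
rewrite opprD addrACA (le_lt_trans (ler_normD _ _)) //.
by rewrite [e]splitr ltrD.
Qed.

Lemma tendsM u v l m : tends u l -> tends v m -> tends (fun q => u q * v q) (l * m).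
Proof.
move=> ul vm e e0.
pose B := `|m| + `|l| + 1; have B0 : 0 < B by rewrite ltr_wpDl // addr_ge0.
have eB : 0 < e / B / 2%:R by rewrite !divr_gt0.
have [Q1 lu] := ul _ eB; have [Q2 mv] := vm _ eB; have [Q3 v1] := vm _ ltr01.
exists (maxn Q1 (maxn Q2 Q3)) => q; rewrite !geq_max => /and3P[/lu {}lu /mv {}mv /v1 {}v1].
have -> : u q * v q - l * m = (u q - l) * v q + l * (v q - m) by ring.
have vB : `|v q| <= B.
  have -> : v q = (v q - m) + m by ring.
  by rewrite (le_trans (ler_normD _ _)) // /B; have := normr_ge0 l; lra.
rewrite (le_lt_trans (ler_normD _ _)) // !normrM.
have -> : e = (e / B / 2%:R) * B + B * (e / B / 2%:R).
  by field; rewrite lt0r_neq0.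
apply: ltr_leD.
  by apply: (@le_lt_trans _ _ (`|u q - l| * B)); rewrite ?ler_wpM2l // ltr_pM2r.
by apply: ler_pM => //; [rewrite /B; have := normr_ge0 m; lra | apply: ltW].
Qed.

Lemma tends_inv : tends (fun q => q%:R^-1) 0.
Proof.
move=> e e0; have [n en] : exists n : nat, e^-1 < n%:R.
  by exists (Num.Def.archi_bound e^-1); apply: archi_boundP; rewrite invr_ge0 ltW.
exists n.+1 => q nq; have q0 : 0 < q%:R :> rat by rewrite ltr0n (leq_trans _ nq).
rewrite subr0 ger0_norm ?invr_ge0 ?(ltW q0) // -[e]invrK ltf_pV2 ?posrE ?invr_gt0 //.
by rewrite (lt_le_trans en) // ler_nat ltnW.
Qed.

Lemma tends_X u l n : tends u l -> tends (fun q => u q ^+ n) (l ^+ n).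
Proof.
move=> ul; elim: n => [|n IHn]; first exact: tends_cst.
rewrite exprS; by apply: (@tends_eq _ _ _ 0) (tendsM ul IHn) => q _; rewrite exprS.
Qed.

Lemma tends_sum n (u : nat -> nat -> rat) l : (forall i, (i < n)%N -> tends (u i) (l i)) ->
  tends (fun q => \sum_(i < n) u i q) (\sum_(i < n) l i).
Proof.
elim: n => [|n IHn] ul.
  by rewrite big_ord0; apply: (@tends_eq _ _ _ 0) (tends_cst 0) => q _; rewrite big_ord0.
rewrite big_ord_recr; apply: (@tends_eq (fun q => \sum_(i < n) u i q + u n q) _ _ 0).
  by move=> q _; rewrite big_ord_recr.
by apply: tendsD; [apply: IHn => i ltin; apply: ul; apply: ltnW | apply: ul].
Qed.

Lemma tends_comp u l (s : nat -> nat) :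
  (forall M, exists Q, forall q, (Q <= q)%N -> (M <= s q)%N) ->
  tends u l -> tends (fun q => u (s q)) l.
Proof. by move=> sM ul e /ul[M lM]; have [Q QM] := sM M; exists Q => q /QM/lM. Qed.

Lemma tends_squeeze u v w l Q : (forall q, (Q <= q)%N -> u q <= w q <= v q) ->
  tends u l -> tends v l -> tends w l.
Proof.
move=> uwv ul vl e e0; have [Q1 lu] := ul _ e0; have [Q2 lv] := vl _ e0.
exists (maxn Q (maxn Q1 Q2)) => q; rewrite !geq_max => /and3P[/uwv/andP[uw wv] /lu + /lv].
rewrite !ltr_norml; lra.
Qed.

Lemma tends_uniq u l m : tends u l -> tends u m -> l = m.
Proof.
move=> ul um; apply/eqP; rewrite -subr_eq0 -normr_le0 leNgt; apply/negP => lm0.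
have e0 : 0 < `|l - m| / 2%:R by rewrite divr_gt0.
have [Q1 lu] := ul _ e0; have [Q2 mu] := um _ e0.
have := lu (maxn Q1 Q2) (leq_maxl _ _); have := mu (maxn Q1 Q2) (leq_maxr _ _).
set x := u _ => xm xl; have := ler_distD x l m; rewrite (distrC l x); lra.
Qed.

(** The limit is 1/i! for i = d and 0 for i < d. Only its vanishing is recorded, which is what
    detects a leading coefficient. *)
Lemma tends_bin i d : (i <= d)%N ->
  exists l, tends (fun q => 'C(q, i)%:R / q%:R ^+ d) l /\ (l == 0) = (i < d)%N.
Proof.
have [l [il l0]] : exists l, tends (fun q => 'C(q, i)%:R / q%:R ^+ i) l /\ l != 0.
  elim: i => [|i [l [il l0]]].
    exists 1; split; last exact: oner_neq0.
    by apply: (@tends_eq _ _ _ 0) (tends_cst 1) => q _; rewrite bin0 expr0 divr1.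
  exists (l * ((1 - i%:R * 0) / i.+1%:R)); split; last first.
    by rewrite mulr0 subr0 mulf_neq0 // mul1r invr_neq0 // pnatr_eq0.
  apply: (@tends_eq (fun q =>
    ('C(q, i)%:R / q%:R ^+ i) * ((1 + (- i%:R) * q%:R^-1) * i.+1%:R^-1)) _ _ i.+1).
    move=> q iq; have q0 : q%:R != 0 :> rat by rewrite pnatr_eq0 -lt0n (leq_trans _ iq).
    have i0 : i.+1%:R != 0 :> rat by rewrite pnatr_eq0.
    have := congr1 (fun n => n%:R : rat) (mul_bin_left q i).
    rewrite !natrM natrB ?(ltnW iq) // => E.
    have -> : 'C(q, i.+1)%:R = (q%:R - i%:R) * 'C(q, i)%:R / i.+1%:R :> rat.
      by rewrite -E mulrAC mulfV // mul1r.
    have y0 := expf_neq0 i q0; rewrite exprS; set y := _ ^+ i in y0 *.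
    by field; rewrite addrC natr1 y0 i0 q0.
  apply: tendsM => //; apply: tendsM; last exact: tends_cst.
  rewrite -mulNr; apply: tendsD; first exact: tends_cst.
  by apply: tendsM tends_inv; apply: tends_cst.
move=> id; exists (l * 0 ^+ (d - i)); split; last first.
  by rewrite mulf_eq0 (negbTE l0) expf_eq0 eqxx andbT subn_gt0.
apply: (@tends_eq _ _ _ 0) (tendsM il (tends_X (d - i) tends_inv)) => q _.
by rewrite -[in RHS](subnKC id) exprD invfM mulrA exprVn.
Qed.

(** Division by j ^ n leaves only the top binomial in the limit. If d < n the bound forces this
    limit to be 0, so [a n] vanishes and the number of terms can be lowered. *)
Lemma newton_growth n (a : nat -> rat) d C :
  (forall j, (0 < j)%N -> `|\sum_(i < n) 'C(j, i)%:R * a i| <= C * j%:R ^+ d) ->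
  exists r, tends (fun j => (\sum_(i < n) 'C(j, i)%:R * a i) / j%:R ^+ d) r.
Proof.
have conv m k : (m <= k.+1)%N -> exists r : nat -> rat,
    tends (fun j => (\sum_(i < m) 'C(j, i)%:R * a i) / j%:R ^+ k) (\sum_(i < m) r i * a i)
    /\ forall i, (i <= k)%N -> (r i == 0) = (i < k)%N.
  move=> mk; have /choice[l lP] i : exists l, (i <= k)%N ->
      tends (fun q => 'C(q, i)%:R / q%:R ^+ k) l /\ (l == 0) = (i < k)%N.
    have [/tends_bin[l lP]|] := leqP i k; first by exists l.
    by exists 0.
  exists l; split; last by move=> i /lP[].
  apply: (@tends_eq (fun j => \sum_(i < m) ('C(j, i)%:R / j%:R ^+ k) * a i) _ _ 0).
    by move=> q _; rewrite mulr_suml; apply: eq_bigr => i _; rewrite mulrAC.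
  apply: (tends_sum (u := fun i q => ('C(q, i)%:R / q%:R ^+ k) * a i)
                    (l := fun i => l i * a i)) => i im.
  by apply: tendsM (tends_cst _); have [] := lP i (leq_trans im mk).
elim: n => [|n IHn] bnd; first by have [r [? _]] := conv 0%N d isT; eexists; eassumption.
have [nd|dn] := leqP n d; first by have [r [? _]] := conv n.+1 d nd; eexists; eassumption.
have an0 : a n = 0.
  have [r [rn r0]] := conv n.+1 n (leqnn _).
  have t0 : tends (fun j => (\sum_(i < n.+1) 'C(j, i)%:R * a i) / j%:R ^+ n) 0.
    have c0 c : tends (fun j => c * j%:R^-1) 0.
      by rewrite -(mulr0 c); apply: tendsM tends_inv; apply: tends_cst.
    apply: (@tends_squeeze (fun j => - C * j%:R^-1) (fun j => C * j%:R^-1) _ _ 1) => // j j0.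
    have jR : 0 < j%:R :> rat by rewrite ltr0n.
    have jn : 0 < j%:R ^+ n :> rat by rewrite exprn_gt0.
    rewrite mulNr -ler_norml normrM [`|_^-1|]gtr0_norm ?invr_gt0 //.
    rewrite ler_pdivrMr // (le_trans (bnd _ j0)) // -mulrA.
    have C0 : 0 <= C.
      have := le_trans (normr_ge0 _) (bnd _ j0).
      by rewrite pmulr_lge0 // exprn_gt0.
    rewrite ler_wpM2l // -(subnKC dn) exprD exprS mulrA mulrA mulVf ?gt_eqF // mul1r.
    by rewrite ler_peMr ?exprn_ge0 ?(ltW jR) // exprn_ege1 // ler1n.
  have := tends_uniq rn t0; rewrite big_ord_recr big1 => [/eqP|i _] /=.
    by rewrite add0r mulf_eq0 r0 // ltnn => /eqP.
  by have /eqP-> : r i == 0; rewrite ?mul0r // r0 ?ltn_ord // ltnW.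
have sumE j : \sum_(i < n.+1) 'C(j, i)%:R * a i = \sum_(i < n) 'C(j, i)%:R * a i.
  by rewrite big_ord_recr /= an0 mulr0 addr0.
have [|r rn] := IHn; first by move=> j j0; rewrite -sumE bnd.
by exists r; apply: (@tends_eq _ _ _ 0) rn => j _; rewrite sumE.
Qed.

End Tends.

(** * Limits of monotone quasi-polynomials *)

Lemma fdiffs_scale n p Q f j :
  fdiffs (nseq n 1%N) (fun i => f (p * (Q + i))%N) j = fdiffs (nseq n p) f (p * (Q + j))%N.
Proof. by elim: n j => //= n IHn j; rewrite /fdiff !IHn addnA mulnDr muln1. Qed.

(* By monotonicity it is enough to look at the multiples of a common period, along
   which [f] is eventually a polynomial. *)
Lemma quasi_poly_limit (f : nat -> rat) d C :
  quasi_poly f -> {in leq 1 &, {homo f : m n / (m <= n)%N >-> m <= n}} ->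
  (forall q, (0 < q)%N -> 0 <= f q <= C * q%:R ^+ d) ->
  exists r, tends (fun q => f q / q%:R ^+ d) r.
Proof.
move=> /quasi_poly_period[p [n [Q0 [p0 f0]]]] fmono fbnd.
(* The successor keeps [p * (Q + j)] positive, where monotonicity and the bound on [f] are
   available. *)
pose Q := Q0.+1; pose g j := f (p * (Q + j))%N.
have [a ga] : exists a : nat -> rat, forall j, g j = \sum_(i < n) 'C(j, i)%:R * a i.
  apply: newton => j; rewrite fdiffs_scale f0 // (@leq_trans (Q + j)) ?leq_pmull //.
  by rewrite (leq_trans (leqnSn _)) // leq_addr.
have Qj0 j : (0 < p * (Q + j))%N by rewrite muln_gt0 p0.
have C0 : 0 <= C.
  by have /andP[h1 h2] := fbnd 1%N isT; have := le_trans h1 h2; rewrite expr1n mulr1.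
(* For j >= 1 one has [p * (Q + j) <= p * Q.+1 * j], whence the constant. *)
have [|r] := @newton_growth n a d (C * (p * Q.+1)%:R ^+ d).
  move=> j j0; rewrite -ga; have /andP[h1 h2] := fbnd _ (Qj0 j).
  rewrite ger0_norm // (le_trans h2) // -mulrA ler_wpM2l // -exprMn.
  rewrite lerXn2r ?nnegrE // -?natrM // ?ler0n // ler_nat -mulnA leq_pmul2l //.
  by move: j0; clear; nia.
under eq_fun do rewrite -ga.
move=> gr.
(* For large q this gives [p * (Q + s q) <= q < p * (Q + s q + 1)], so that [f q] lies between
   [g (s q)] and [g (s q + 1)]. *)
pose s q := (q %/ p - Q)%N.
have s_oo M : exists Q', forall q, (Q' <= q)%N -> (M <= s q)%N.
  exists (p * (M + Q))%N => q Mq; rewrite /s.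
  have : (M + Q <= q %/ p)%N by rewrite leq_divRL // mulnC.
  by clear; lia.
have sp k : tends (fun q => (s q + k)%:R / q%:R) p%:R^-1.
  have pR : 0 < p%:R :> rat by rewrite ltr0n.
  pose D := (Q + k + 1)%N.
  apply: (@tends_squeeze (fun q => p%:R^-1 + (- D%:R) * q%:R^-1) (fun q => p%:R^-1 + D%:R * q%:R^-1) _ _ (p * Q).+1).
  - move=> q Qq; have qR : 0 < q%:R :> rat by rewrite ltr0n (leq_trans _ Qq).
    have -> : p%:R^-1 = q%:R / p%:R / q%:R :> rat by rewrite mulrAC mulfV ?mul1r ?gt_eqF.
    rewrite -!mulrDl !ler_pM2r ?invr_gt0 //.
    have Qqp : (Q <= q %/ p)%N by rewrite leq_divRL // mulnC ltnW.
    rewrite /D !natrD /s natrB //.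
    have h1 : (q %/ p)%:R <= q%:R / p%:R :> rat.
      by rewrite ler_pdivlMr // -natrM ler_nat leq_trunc_div.
    have h2 : q%:R / p%:R <= (q %/ p)%:R + 1 :> rat.
      by rewrite ler_pdivrMr // natr1 -natrM ler_nat ltnW // ltn_ceil.
    have h3 : 0 <= Q%:R :> rat by [].
    have h4 : 0 <= k%:R :> rat by [].
    by apply/andP; split; lra.
  - by rewrite -[X in tends _ X]addr0 -(mulr0 (- D%:R)); apply: tendsD; [|apply: tendsM tends_inv]; apply: tends_cst.
  - by rewrite -[X in tends _ X]addr0 -(mulr0 D%:R); apply: tendsD; [|apply: tendsM tends_inv]; apply: tends_cst.
have gs k : tends (fun q => g (s q + k)%N / q%:R ^+ d) (r * p%:R^-1 ^+ d).
  have gk : tends (fun q => g (s q + k)%N / (s q + k)%:R ^+ d) r.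
    apply: (tends_comp (u := fun j => g j / j%:R ^+ d) (s := fun q => s q + k)%N) gr => M.
    by have [Q' Q'P] := s_oo M; exists Q' => q /Q'P h; rewrite (leq_trans h) ?leq_addr.
  have [Q' Q'P] := s_oo 1%N.
  apply: (@tends_eq _ _ _ Q') (tendsM gk (tends_X d (sp k))) => q /Q'P sq.
  have sk0 : (s q + k)%:R ^+ d != 0 :> rat.
    by rewrite expf_neq0 // pnatr_eq0 -lt0n (leq_trans sq) ?leq_addr.
  by rewrite expr_div_n mulrA divfK.
exists (r * p%:R^-1 ^+ d).
apply: (@tends_squeeze _ _ _ _ (p * Q).+1) (gs 0%N) (gs 1%N) => q Qq.
have qR : 0 < q%:R :> rat by rewrite ltr0n (leq_trans _ Qq).
have Qqp : (Q <= q %/ p)%N by rewrite leq_divRL // mulnC ltnW.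
have q0 : (0 < q)%N by rewrite (leq_trans _ Qq).
rewrite !ler_pM2r ?invr_gt0 ?exprn_gt0 // /g addn0 addnA /s subnKC //.
have qp0 : (0 < q %/ p)%N := leq_trans (ltn0Sn _) Qqp.
apply/andP; split; apply: fmono => //; rewrite ?addn1.
- by rewrite -topredE /= muln_gt0 p0.
- by rewrite mulnC leq_trunc_div.
- by rewrite -topredE /= muln_gt0 p0.
- by rewrite mulnC ltnW // ltn_ceil.
Qed.

(** * Hilbert functions of graded monoids *)

Definition has_card (T : eqType) (P : T -> Prop) (k : nat) : Prop :=
  exists s : seq T, [/\ uniq s, size s = k & forall x, P x <-> x \in s].

Section HasCard.
Variable T : eqType.
Implicit Types P Q : T -> Prop.

Lemma has_card_uniq P k k' : has_card P k -> has_card P k' -> k = k'.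
Proof.
move=> [s [us <- Ps]] [s' [us' <- Ps']]; apply/perm_size/uniq_perm => // x.
by apply/idP/idP => [/Ps/Ps'|/Ps'/Ps].
Qed.

Lemma eq_has_card P Q k : (forall x, P x <-> Q x) -> has_card P k -> has_card Q k.
Proof. by move=> PQ [s [us sk Ps]]; exists s; split=> // x; rewrite -PQ. Qed.

Lemma has_card_filter P Q k : has_card P k -> exists k', has_card (fun x => P x /\ Q x) k'.
Proof.
move=> [s [us _ Ps]]; exists (size [seq x <- s | `[< Q x >]]), [seq x <- s | `[< Q x >]].
split=> [||x]; rewrite ?filter_uniq // mem_filter.
by split=> [[/Ps -> /asboolP ->]|/andP[/asboolP Qx /Ps]].
Qed.

Lemma has_cardU P Q k k' : (forall x, P x -> ~ Q x) ->
  has_card P k -> has_card Q k' -> has_card (fun x => P x \/ Q x) (k + k').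
Proof.
move=> PQ [s [us <- Ps]] [s' [us' <- Qs']]; exists (s ++ s'); split=> [||x].
- rewrite cat_uniq us us' andbT; apply/hasPn => x /= /Qs' Qx.
  by apply/negP => /Ps /PQ.
- exact: size_cat.
- rewrite mem_cat; split=> [[/Ps->//|/Qs'->]|/orP[/Ps|/Qs']]; rewrite ?orbT; by [left | right |].
Qed.

Lemma has_card_image (f : T -> T) P k :
  (forall x y, P x -> P y -> f x = f y -> x = y) ->
  has_card P k -> has_card (fun y => exists x, P x /\ y = f x) k.
Proof.
move=> finj [s [us <- Ps]]; exists (map f s); split=> [||y].
- by rewrite map_inj_in_uniq // => x x' /Ps Px /Ps; apply: finj.
- exact: size_map.
- split=> [[x [/Ps xs ->]]|/mapP[x /Ps Px ->]]; first exact: map_f.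
  by exists x.
Qed.

Lemma has_card0 P : (forall x, ~ P x) -> has_card P 0.
Proof. by move=> P0; exists [::]; split=> // x; split=> // /P0. Qed.

End HasCard.

Definition quasi_poly_card (T : eqType) (X : nat -> T -> Prop) : Prop :=
  exists2 f : nat -> nat, (forall q, has_card (X q) (f q)) & quasi_poly (fun q => (f q)%:R).

Section Graded.
Variables (N : nmodType) (oo : N).
Hypothesis addoo : forall a : N, a + oo = oo.
Hypothesis addIoo : forall a b c : N, a + b = a + c -> a + b <> oo -> b = c.

(* Induction on the generators: translation by the last one, [y], maps the
   complement of the colon ideal (I : y) into the complement of [I], and what is
   missed is spanned by the other generators.  The ideals (I : y^j) stabilise. *)
Lemma quasi_poly_span (ys : seq (N * nat)) (I : N * nat -> Prop) :
  all (fun y => 0 < y.2)%N ys ->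
  (forall z, z.1 = oo -> I z) ->
  (forall z t, I z -> span ys t -> I (z + t)) ->
  quasi_poly_card (fun q x => span ys (x, q) /\ ~ I (x, q)).
Proof.
elim: ys I => [|y ys IHys] I /=.
  move=> _ _ _; have /choice[f fP] q : exists k,
      has_card (fun x => span [::] (x, q) /\ ~ I (x, q)) k.
    case: q => [|q]; last by exists 0%N; apply: has_card0 => x [/span_nil].
    have [k kP] : exists k, has_card (fun x : N => x = 0 /\ ~ I (x, 0%N)) k.
      apply: (@has_card_filter _ _ _ 1); exists [:: 0]; split=> // x.
      by rewrite inE; split=> /eqP.
    exists k; apply: eq_has_card kP => x; split=> -[xE nI]; split=> //.
      by apply/span_nil; rewrite xE.
    by move/span_nil: xE => [].
  exists f => //; apply: (@quasi_poly0 1) => -[//|q] _.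
  rewrite (_ : f q.+1 = 0%N) //.
  by apply: has_card_uniq (fP q.+1) _; apply: has_card0 => x [/span_nil].
move=> /andP[y0 ys0] Ioo ID; set w := y.2 in y0.
(* [Ic j] is the colon ideal of [I] by [y *+ j], and [X j] the part of the span outside it. The
   elements of [X j] that are not translates by [y] form [Y j]; they are spanned by [ys] alone, so
   the induction hypothesis counts them. *)
pose Ic j z := I (z + y *+ j).
pose Y j q x := span ys (x, q) /\
  ~ (Ic j (x, q) \/ exists t, span (y :: ys) t /\ (x, q) = y + t).
pose X j q x := span (y :: ys) (x, q) /\ ~ Ic j (x, q).
have /choice[G GP] j : exists f : nat -> nat,
    (forall q, has_card (Y j q) (f q)) /\ quasi_poly (fun q => (f q)%:R).
  suff [f] : quasi_poly_card (Y j) by exists f.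
  apply: (IHys (fun z => Ic j z \/ exists t, span (y :: ys) t /\ z = y + t)) => //.
    by move=> z zoo; left; apply: Ioo; rewrite /= zoo addrC addoo.
  move=> z t [Iz|[t' [st' ->]]] /(span_consr y) st; [left|right].
    by rewrite /Ic addrAC; apply: ID.
  by exists (t' + t); split; [apply: spanD | rewrite addrA].
have sy : span (y :: ys) y by apply: span_mem; rewrite inE eqxx.
have XE j q x : X j q x <->
    Y j q x \/ exists x', (w <= q)%N /\ X j.+1 (q - w)%N x' /\ x = y.1 + x'.
  split=> [[sx nI]|[[sx nI]|[x' [wq [[sx' nI] ->]]]]].
  - have [[[x' q'] [st]]|nt] := pselect (exists t, span (y :: ys) t /\ (x, q) = y + t).
      move=> E; have xE := congr1 fst E; have qE := congr1 snd E; rewrite /= in xE qE.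
      right; exists x'; rewrite qE leq_addr addKn; split=> //; split=> //; split=> //.
      by move: nI; apply: contra_not; rewrite /Ic mulrS addrA E [_ + y]addrC.
    left; split; last by case.
    move/span_cons: (sx) => [[|k] [t [st xE]]]; first by rewrite xE mulr0n add0r.
    case: nt; exists (y *+ k + t); split; last by rewrite addrA -mulrS.
    by apply: spanD; [apply: spanMn | apply: span_consr].
  - by split; [apply: span_consr | move: nI; apply: contra_not; left].
  - have E : (y.1 + x', q) = y + (x', q - w)%N by rewrite -{1}(subnKC wq).
    rewrite /X E.
    split; first exact: spanD.
    by move: nI; apply: contra_not; rewrite /Ic mulrS addrA [_ + y]addrC.
have cardS j q k : (if (w <= q)%N then has_card (X j.+1 (q - w)%N) k else k = 0%N) ->
    has_card (X j q) (G j q + k).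
  move=> kP; apply: eq_has_card (fun x => iff_sym (XE j q x)) _.
  apply: has_cardU; last first.
  - case: ifP kP => [wq kP|_ ->]; last by apply: has_card0 => x [x' []].
    have inj x x' : X j.+1 (q - w)%N x -> X j.+1 (q - w)%N x' -> y.1 + x = y.1 + x' -> x = x'.
      move=> [_ nI] _ xx'; apply: (addIoo xx') => yx; apply: nI; apply: Ioo.
      by rewrite raddfD raddfMn /= mulrS addrA [x + _]addrC yx addrC addoo.
    apply: eq_has_card (has_card_image inj kP) => x.
    by split=> [[x' [Xx' ->]]|[x' [_ [Xx' ->]]]]; exists x'.
  - by have [] := GP j.
  - move=> x [_ nI] [x' [wq [[sx' _] xE]]]; apply: nI; right.
    by exists (x', q - w)%N; split=> //; rewrite xE -{1}(subnKC wq).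
have XF j q : exists k, has_card (X j q) k.
  have [b] := ubnP q; elim: b j q => // b IHb j q qb.
  have [wq|qw] := leqP w q; last first.
    by exists (G j q + 0)%N; apply: cardS; rewrite leqNgt qw.
  have [|k kP] := IHb j.+1 (q - w)%N; first by move: y0 qb wq; clear; lia.
  by exists (G j q + k)%N; apply: cardS; rewrite wq.
have /choice[F FP] j : exists f : nat -> nat, forall q, has_card (X j q) (f q).
  by have /choice[f fP] := XF j; exists f.
have FS j q : F j (q + w)%N = (G j (q + w) + F j.+1 q)%N.
  apply: has_card_uniq (FP j _) _; apply: cardS.
  by rewrite leq_addl addnK.
(* Dickson's lemma is applied to the vectors (j, e) with j y + e in [I]; [j0] bounds the first
   coordinate of the finitely many vectors it returns. *)
have [j0 stab] : exists j0, forall j z, (j0 <= j)%N -> span (y :: ys) z -> Ic j z <-> Ic j0 z.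
  have [l [lI domin]] := dickson (size (y :: ys)).+1
    (fun u => I (y *+ u 0%N + lin (y :: ys) (fun i => u i.+1))).
  exists (\max_(v <- l) v 0%N)%N => j z; set j0 := (\max_(v <- l) _)%N => j0j sz.
  split=> [Iz|]; last first.
    by rewrite /Ic -(subnKC j0j) mulrnDr addrA => /ID; apply; apply: spanMn.
  have [e zE] := sz.
  have [|v vl vu] := domin (fun i => if i is i'.+1 then e i' else j).
    by rewrite addrC -zE.
  have v0 : (v 0 <= j0)%N by rewrite /j0 (big_rem v) //= leq_maxl.
  rewrite /Ic -(subnKC v0) mulrnDr zE (lin_subK (e' := fun i => v i.+1)) => [|i]; last exact: (vu i.+1).
  rewrite addrACA; apply: ID; first by rewrite addrC; apply: lI.
  by apply: spanD; [eexists | apply: spanMn].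
have Fj0 q : F j0.+1 q = F j0 q.
  apply: has_card_uniq (FP j0.+1 q) _; apply: eq_has_card (FP j0 q) => x.
  by split=> -[sx nI]; split=> //; have S := stab _ _ (leqnSn j0) sx;
    move: nI; apply: contra_not => /S.
(* At [j0] the recurrence [FS] is a difference equation for [F j0]; below [j0] it expresses [F j]
   through [F j.+1]. *)
have QF k : quasi_poly (fun q => (F (j0 - k)%N q)%:R).
  elim: k => [|k IHk].
    rewrite subn0; apply: (quasi_poly_fdiff y0).
    apply: (@quasi_poly_eq _ _ 0) ((quasi_poly_shift _ w).2 (GP j0).2) => q _.
    by rewrite /fdiff FS Fj0 natrD; ring.
  have [kj0|] := ltnP k j0; last first.
    rewrite -subn_eq0 => /eqP kj0; move: IHk; rewrite subnS kj0 //.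
  apply/(quasi_poly_shift _ w); rewrite -(subnSK kj0) in IHk.
  have QG := (quasi_poly_shift _ w).2 (GP (j0 - k.+1)%N).2.
  apply: (@quasi_poly_eq _ _ 0) (quasi_polyD QG IHk) => q _.
  by rewrite FS natrD.
exists (F 0%N); last by have := QF j0; rewrite subnn.
by move=> q; apply: eq_has_card (FP 0%N q) => x; rewrite /X /Ic mulr0n addr0.
Qed.

Lemma linP (ys : seq (N * nat)) e :
  lin ys e = (lin [seq y.1 | y <- ys] e, lin [seq y.2 | y <- ys] e).
Proof.
elim: ys e => [|y ys IHys] e; first by rewrite !lin_nil.
by rewrite /= !lin_cons IHys [LHS]surjective_pairing !raddfD !raddfMn.
Qed.

Lemma span_ind (V : nmodType) (ys : seq V) (R : V -> Prop) :
  R 0 -> (forall y z, R y -> R z -> R (y + z)) -> (forall y, y \in ys -> R y) ->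
  forall z, span ys z -> R z.
Proof.
move=> R0 RD; elim: ys => [|y ys IHys] Rys z; first by move/span_nil->.
move/span_cons=> [k [t [st ->]]]; apply: (RD); last first.
  by apply: IHys st => y' y'ys; apply: Rys; rewrite inE y'ys orbT.
elim: k => [|k IHk]; first by rewrite mulr0n.
by rewrite mulrS; apply: RD => //; apply: Rys; rewrite inE eqxx.
Qed.

Variable G : seq N.
Hypothesis spanG : forall x, span G x.

(** The degree q is linear in the coefficients of (x, q), so x = q a + t is a linear equation in
    those coefficients and in the coefficients of t over [G]. Its solutions with finite value admit
    subtraction. *)
Lemma span_inter (ys : seq (N * nat)) (a : N) : all (fun y => 0 < y.2)%N ys ->
  exists2 ys', all (fun y => 0 < y.2)%N ys' & forall x q, x <> oo ->
    span ys' (x, q) <-> span ys (x, q) /\ exists t, x = a *+ q + t.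
Proof.
move=> /allP ys0; pose m := size ys.
pose val u := (lin ys u).1.
pose P u := val u = a *+ (lin ys u).2 + lin G (fun i => u (m + i)%N).
have [u [Pu uoo]|u v [Pu uoo] Pv vu|H [HP HI]] :=
    @subtractive_ind (m + size G) P (fun u => P u /\ val u <> oo) => //.
  have vE : lin ys u = lin ys v + lin ys (fun i => u i - v i)%N.
    by apply: lin_subK => i im; apply: vu; rewrite ltn_addr.
  have vE1 : val u = val v + val (fun i => u i - v i)%N by rewrite /val vE.
  have vG : lin G (fun i => u (m + i)%N) =
      lin G (fun i => v (m + i)%N) + lin G (fun i => u (m + i) - v (m + i))%N.
    by apply: lin_subK => i im; apply: vu; rewrite ltn_add2l.
  split; last by move=> E; apply: uoo; rewrite vE1 E addoo.
  apply: (addIoo (a := val v)); last by rewrite -vE1.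
  rewrite -vE1 Pu vE vG /= mulrnDr addrACA; congr (_ + _); exact: esym.
(* Solutions of degree 0 are dropped: the elements of [ys] have positive degree, so these contribute
   only 0 to the span. *)
exists [seq y <- [seq lin ys v | v <- H] | 0 < y.2]%N.
  exact: filter_all.
move=> x q xoo; split.
  pose R z := span ys z /\ exists t, z.1 = a *+ z.2 + t.
  apply: (@span_ind _ _ R).
  - by split; [apply: span0 | exists 0; rewrite mulr0n addr0].
  - move=> y z [sy [t yE]] [sz [t' zE]]; split; first exact: spanD.
    by exists (t + t'); rewrite /= yE zE mulrnDr addrACA.
  - move=> y; rewrite mem_filter => /andP[_ /mapP[v /HP Pv ->]].
    by split; [exists v | eexists; apply: Pv].
move=> [[e xE] [t]]; have [d ->] := spanG t => xE'.
pose u i := if (i < m)%N then e i else d (i - m)%N.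
have uE : lin ys u = (x, q) by rewrite xE; apply: eq_lin => i im; rewrite /u im.
have uG : lin G (fun i => u (m + i)%N) = lin G d.
  by apply: eq_lin => i _; rewrite /u ltnNge leq_addr addKn.
rewrite -uE; apply: (HI (fun u => span _ (lin ys u))).
- by move=> {uE uG}u u0; rewrite lin0 => [|i im]; [apply: span0 | rewrite u0 ?ltn_addr].
- move=> {uE uG}u v Qu vH vu IH.
  have vu' i : (i < m)%N -> (v i <= u i)%N by move=> im; rewrite vu ?ltn_addr.
  rewrite (lin_subK vu'); apply: spanD => //.
  have [v0|vpos] := posnP (lin ys v).2; last first.
    by apply: span_mem; rewrite mem_filter vpos map_f.
  rewrite lin0; first exact: span0.
  move=> i im; move: v0; rewrite linP /lin /= size_map => /eqP.
  rewrite sum_nat_eq0 => /forallP/(_ (Ordinal im)) /=.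
  rewrite (nth_map 0) // -[_ *+ _]mulr_natr muln_eq0.
  by have := ys0 _ (mem_nth 0 im); rewrite lt0n => /negbTE -> /eqP; rewrite natn.
- by rewrite /P /val uE uG.
Qed.

(** The count for [a :: A] in the span of [ys] is the count for [A] there minus the count for [A] in
    the span of the [ys'] given by [span_inter]; hence the induction runs over arbitrary [ys]. *)
Lemma quasi_poly_sieve (A : seq N) (ys : seq (N * nat)) :
  all (fun y => 0 < y.2)%N ys ->
  quasi_poly_card (fun q x => x <> oo /\ span ys (x, q) /\
    forall a, a \in A -> ~ exists t, x = a *+ q + t).
Proof.
elim: A ys => [|a A IHA] ys ys0.
  have [] := @quasi_poly_span ys (fun z => z.1 = oo) ys0 => //.
    by move=> z t /= ->; rewrite addrC addoo.
  move=> f fP Qf; exists f => // q; apply: eq_has_card (fP q) => x /=.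
  by split=> [[]|[? []]].
have [ys' ys'0 ys'P] := span_inter a ys0.
have [f fP Qf] := IHA _ ys0; have [g gP Qg] := IHA _ ys'0.
have /choice[h hP] q : exists k, has_card (fun x => x <> oo /\ span ys (x, q) /\
    forall a', a' \in a :: A -> ~ exists t, x = a' *+ q + t) k.
  have [k kP] := has_card_filter (fun x => ~ exists t, x = a *+ q + t) (fP q).
  exists k; apply: eq_has_card kP => x; split.
    move=> [[xoo [sx nA]] na]; split=> //; split=> // a'; rewrite inE.
    by case/orP=> [/eqP->|/nA].
  move=> [xoo [sx nA]]; split; last by apply: nA; rewrite inE eqxx.
  by split=> //; split=> // a' a'A; apply: nA; rewrite inE a'A orbT.
exists h => //; apply: (@quasi_poly_eq _ _ 0) (quasi_polyB Qf Qg) => q _.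
suff -> : f q = (h q + g q)%N by rewrite natrD; ring.
apply: has_card_uniq (fP q) _.
apply: eq_has_card (has_cardU _ (hP q) (gP q)) => x.
  split=> [[[xoo [sx nA]]|[xoo [sx nA]]]|[xoo [sx nA]]].
  - by split=> //; split=> // a' a'A; apply: nA; rewrite inE a'A orbT.
  - by split=> //; split=> //; have [] := (ys'P x q xoo).1 sx.
  - have [ta|nta] := pselect (exists t, x = a *+ q + t); [right|left].
      by split=> //; split=> //; apply/ys'P.
    split=> //; split=> // a'; rewrite inE => /orP[/eqP->|/nA] //.
move=> [xoo [sx nA]] [_ [/(ys'P _ _ xoo)[_ ta] _]].
by apply: (nA a); rewrite ?inE ?eqxx.
Qed.

End Graded.

(** * Faces and growth *)

Section Faces.
Variables (N : nmodType) (oo : N).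
Hypothesis addoo : forall a : N, a + oo = oo.
Hypothesis addIoo : forall a b c : N, a + b = a + c -> a + b <> oo -> b = c.
Hypothesis redoo : forall (a : N) k, (0 < k)%N -> a *+ k = oo -> a = oo.
Variable G : seq N.
Hypothesis spanG : forall x, span G x.

(* The set of all [y] with [face x y] is the smallest filter containing [x], that is,
   the complement of the largest prime ideal avoiding [x]. *)
Definition face (x y : N) : Prop := exists k z, x *+ k = y + z.

Lemma face_refl x : face x x.
Proof. by exists 1%N, 0; rewrite addr0. Qed.

Lemma face0 x : face x 0.
Proof. by exists 0%N, 0; rewrite addr0. Qed.

Lemma faceD x y z : face x (y + z) <-> face x y /\ face x z.
Proof.
split=> [[k [t E]]|[[k [s E]] [l [t E']]]].
  by split; exists k; [exists (z + t) | exists (y + t)]; rewrite E -addrA // addrCA.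
by exists (k + l)%N, (s + t); rewrite mulrnDr E E' addrACA.
Qed.

Lemma face_trans y x z : face x y -> face y z -> face x z.
Proof.
move=> [k [s E]] [l [t E']]; exists (k * l)%N, (t + s *+ l).
by rewrite mulrnA E mulrnDl E' addrA.
Qed.

Lemma faceMn x y k : face x y -> face x (y *+ k).
Proof.
by move=> xy; elim: k => [|k IHk]; rewrite ?mulr0n ?mulrS; [apply: face0 | apply/faceD].
Qed.

Lemma face_Mn x y k : (0 < k)%N -> face x (y *+ k) -> face x y.
Proof. by case: k => // k _; rewrite mulrS => /faceD[]. Qed.

Lemma face_lin x (ys : seq N) e :
  (forall i, (i < size ys)%N -> (0 < e i)%N -> face x ys`_i) <-> face x (lin ys e).
Proof.
split=> [|fx i iys ei].
  elim: ys e => [|y ys IHys] e fx; first by rewrite lin_nil; apply: face0.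
  rewrite lin_cons; apply/faceD; split; last by apply: IHys => i iys; apply: (fx i.+1).
  have [->|e0] := posnP (e 0%N); first by rewrite mulr0n; apply: face0.
  exact/faceMn/(fx 0%N).
elim: ys e i iys ei fx => // y ys IHys e [|i] iys ei; rewrite lin_cons => /faceD[f1 f2].
  exact: face_Mn f1.
by apply: (IHys (fun i => e i.+1)).
Qed.

Lemma addoo_l (a b : N) : a + b <> oo -> a <> oo.
Proof. by move=> ab E; apply: ab; rewrite E addrC addoo. Qed.

Lemma mulrn_oo (a : N) k : (0 < k)%N -> a *+ k <> oo -> a <> oo.
Proof. by case: k => // k _; rewrite mulrS => /addoo_l. Qed.

Lemma face_neq_oo x y : x <> oo -> face x y -> y <> oo.
Proof.
move=> xoo [k [z E]] yoo; apply: xoo; rewrite yoo addrC addoo in E.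
case: k E => [|k] E; last exact: redoo E.
by rewrite -[x]addr0 -(mulr0n x) E addoo.
Qed.

(* [v] generates a face minimal among those strictly containing the face of [u]. *)
Definition step (u v : N) : Prop :=
  [/\ face v u, ~ face u v & forall m, face v m -> face (u + m) v \/ face u m].

(* The quotient of the two faces has rank one: among the relations
   a v + e u = b g + m, pick one with [b / a] maximal (it exists, since the monoid of all
   relations is finitely generated); then [m] cannot generate, modulo [u],
   the face of [v]. *)
Lemma step_rank1 u v g : step u v -> v <> oo -> face v g ->
  exists b a e m, [/\ (0 < b)%N, face u m & g *+ b + m = v *+ a + u *+ e].
Proof.
move=> [vu nuv vmin] voo vg.
have [[k [z E]]|nug] := pselect (face u g).
  exists 1%N, 0%N, k, z; split=> //; last by rewrite mulr0n add0r E.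
  by exists k, g; rewrite addrC.
(* Layout of [w]: entry 0 is the coefficient a of [v], entry 1 the coefficient b of [g], entry 2 the
   coefficient e of [u], and from 3 on come the coefficients of m over [G]. *)
pose val w := v *+ w 0%N + u *+ w 2%N.
pose P w := val w = g *+ w 1%N + lin G (fun i => w i.+3).
have fval w : face v (val w) by apply/faceD; split; apply: faceMn => //; apply: face_refl.
have [//|w1 w2 P1 P2 w21|H [HP HI]] := @subtractive_ind (3 + size G) P P.
  have vE : val w1 = val w2 + val (fun i => w1 i - w2 i)%N.
    by rewrite /val addrACA -!mulrnDr !subnKC // w21.
  have rE : g *+ w1 1%N + lin G (fun i => w1 i.+3) =
      (g *+ w2 1%N + lin G (fun i => w2 i.+3)) +
      (g *+ (w1 1%N - w2 1%N)%N + lin G (fun i => w1 i.+3 - w2 i.+3)%N).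
    rewrite addrACA -mulrnDr subnKC ?w21 //; congr (_ + _).
    by apply: lin_subK => i iG; apply: w21.
  apply: (addIoo (a := val w2)); last by rewrite -vE; apply: face_neq_oo (fval _).
  by rewrite -vE P1 rE P2.
have P00 w : P w -> w 0%N = 0%N -> w 1%N = 0%N.
  rewrite /P /val => Pw w0; case w1: (w 1%N) => [//|b].
  case: nug; exists (w 2%N), (g *+ b + lin G (fun i => w i.+3)).
  by rewrite addrA -mulrS -w1 -Pw w0 mulr0n add0r.
have [k [z E]] := vg; have [c zE] := spanG z.
pose w0 i := if i is i'.+3 then c i' else nth 0%N [:: k; 1%N; 0%N] i.
have Pw0 : P w0 by rewrite /P /val /= mulr0n addr0 E zE.
(* Ratios b / a are compared by cross multiplication. Starting from [w0], of ratio 1 / k, keeps the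
   maximum at least 1 / k, which later gives b > 0. *)
have [w [Pw wpos w0w maxw]] : exists w, [/\ P w, (0 < w 0)%N, (w 0 <= w 1 * w0 0)%N &
    forall h, h \in H -> (h 1 * w 0 <= w 1 * h 0)%N].
  elim: H HP {HI} => [|h H IH] HP.
    exists w0; split=> //; last by rewrite /w0 /= mul1n.
    by rewrite lt0n; apply/eqP => /(P00 _ Pw0).
  have [|w [Pw wpos w0w maxw]] := IH.
    by move=> h' h'H; apply: HP; rewrite inE h'H orbT.
  have Ph : P h by apply: HP; rewrite inE eqxx.
  have [hw|wh] := leqP (h 1 * w 0)%N (w 1 * h 0)%N.
    by exists w; split=> // h'; rewrite inE => /orP[/eqP->|/maxw].
  have hpos : (0 < h 0)%N.
    rewrite lt0n; apply/eqP => h0; have h1 := P00 _ Ph h0.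
    by rewrite h0 h1 muln0 ltnn in wh.
  exists h; split=> //.
    rewrite -(leq_pmul2r wpos) (leq_trans (leq_mul (leqnn _) w0w)) //.
    by rewrite mulnA [X in (_ <= X)%N]mulnAC leq_mul // mulnC ltnW.
  move=> h'; rewrite inE => /orP[/eqP->//|/maxw h'w].
  rewrite -(leq_pmul2r wpos) mulnAC (leq_trans (leq_mul h'w (leqnn _))) //.
  by rewrite mulnAC [X in (_ <= X)%N]mulnAC leq_mul // ltnW.
have {}maxw w' : P w' -> (w' 1 * w 0 <= w 1 * w' 0)%N.
  apply: (HI (fun w' => w' 1 * w 0 <= w 1 * w' 0)%N) => {w'}.
    by move=> w' w'0; rewrite !w'0.
  move=> w' h Pw' hH hw' IH.
  have [h0 h1] := (hw' 0%N isT, hw' 1%N isT).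
  rewrite -(subnKC h0) -(subnKC h1) mulnDl mulnDr.
  by rewrite leq_add // maxw.
have bpos : (0 < w 1)%N.
  by move: wpos w0w; case: (w 1%N) => //; rewrite mul0n leqn0 lt0n => /negP.
pose m := lin G (fun i => w i.+3).
have vm : face v m by have := fval w; rewrite Pw => /faceD[].
(* Otherwise l (u + m) = g + z' for some l. Adding this to l times the maximal relation gives a
   relation with l a and l b + 1, of larger ratio. *)
have [/face_trans/(_ vg)[l [z' lE]]|um] := vmin _ vm; last first.
  by exists (w 1%N), (w 0%N), (w 2%N), m.
have [c' z'E] := spanG z'.
pose w' i := if i is i'.+3 then c' i' else
  nth 0%N [:: (l * w 0)%N; (l * w 1).+1; (l * w 2 + l)%N] i.
have Pw' : P w'.
  rewrite /P /val /= -z'E mulrSr -addrA -lE mulrnDl mulrnDr addrA.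
  have -> : v *+ (l * w 0%N) + u *+ (l * w 2%N) = val w *+ l.
    by rewrite mulrnDl -!mulrnA !(mulnC l).
  by rewrite Pw mulrnDl -mulrnA (mulnC l) -addrA [u *+ l + _]addrC.
have := maxw _ Pw'; rewrite /= mulSn mulnA (mulnC (w 1%N)).
by rewrite -[X in (_ <= X)%N]add0n leq_add2r leqNgt wpos.
Qed.

Fixpoint flag (u : N) (xs : seq N) : Prop :=
  if xs is v :: xs' then step u v /\ flag v xs' else True.

Lemma flag_face u xs : flag u xs -> face (last u xs) u.
Proof.
elim: xs u => [|v xs IHxs] u /=; first by move=> _; apply: face_refl.
by move=> [[vu _ _] /IHxs lv]; apply: face_trans lv vu.
Qed.

Lemma flag_nth u xs i : flag u xs -> (i < size xs)%N -> face (last u xs) xs`_i.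
Proof.
elim: xs u i => // v xs IHxs u [|i] /= [_ fxs] ixs; first exact: flag_face.
exact: IHxs.
Qed.

Definition face_gens (x : N) : nat := count (fun g => `[< face x g >]) G.

(** A face is determined by the generators in it: [x] is a sum of generators lying in its own face,
    and equal counts put all of these in the smaller face of [y]. *)
Lemma face_gens_eq x y : face x y -> (face_gens x <= face_gens y)%N -> face y x.
Proof.
move=> xy cxy; have [e xE] := spanG x; rewrite xE; apply/face_lin => i iG ei.
have xGi : face x G`_i.
  by move: i iG ei; apply/face_lin; rewrite -xE; apply: face_refl.
apply: contrapT => nyGi; move: cxy; rewrite leqNgt => /negP; apply.
rewrite /face_gens !(permP (perm_to_rem (mem_nth 0 iG))) /=.
rewrite (asboolT xGi) (asboolF nyGi) add0n add1n ltnS; apply: sub_count => h.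
by move=> /asboolP yh; apply/asboolP; apply: face_trans xy yh.
Qed.

(** Among the elements of the face of [x] whose face strictly contains that of [u], one with the
    fewest generators in its face is the next step; the count makes the process end. *)
Lemma flag_exists x u : face x u ->
  exists xs, [/\ flag u xs, face x (last u xs) & face (last u xs) x].
Proof.
have mono y z : face y z -> (face_gens z <= face_gens y)%N.
  by move=> yz; apply: sub_count => g /asboolP zg; apply/asboolP; apply: face_trans yz zg.
have [n] := ubnP (face_gens x - face_gens u); elim: n u => // n IHn u ltn xu.
have [ux|nux] := pselect (face u x); first by exists [::].
pose good v := [/\ face x v, face v u & ~ face u v].
have exv : exists k, `[< exists v, good v /\ face_gens v = k >].
  by exists (face_gens x); apply/asboolP; exists x; do !split=> //; apply: face_refl.
case: (ex_minnP exv) => k /asboolP[v [[xv vu nuv] vk]] kmin.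
have [||xs [fxs xl lx]] := IHn v => //.
  have cuv : (face_gens u < face_gens v)%N.
    by rewrite ltnNge; apply/negP => cvu; apply: nuv; apply: face_gens_eq.
  by have := mono _ _ xv; move: cuv ltn; clear; lia.
exists (v :: xs); split=> //=; split=> //; split=> // m vm.
have [um|num] := pselect (face u m); [by right | left].
have vum : face v (u + m) by apply/faceD.
apply: face_gens_eq => //; rewrite vk; apply: kmin; apply/asboolP; exists (u + m).
split=> //; split.
- exact: face_trans xv vum.
- by have /faceD[] := face_refl (u + m).
- by move=> /faceD[].
Qed.

(** The coordinates are the integers m - n, with error terms [w] and [w'] in the face of [u]; all is
    kept on two sides for want of negatives. To go down one step, [step_rank1] rewrites both errors
    through [v], and multiplication by [b * b'] lets both relations be used at once. *)
Lemma flag_coords u xs g : flag u xs -> last u xs <> oo -> face (last u xs) g ->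
  exists K n m w w', [/\ (0 < K)%N, face u w, face u w' &
    g *+ K + lin xs n + w = lin xs m + w'].
Proof.
elim: xs u g => [|v xs IHxs] u g /=.
  move=> _ uoo ug; exists 1%N, (fun=> 0%N), (fun=> 0%N), 0, g; split=> //.
    exact: face0.
  by rewrite !lin_nil !addr0 add0r.
move=> [uv fxs] loo lg.
have voo : v <> oo by apply: face_neq_oo loo _; apply: flag_face.
have [K [n [m [w [w' [K0 vw vw' E]]]]]] := IHxs _ _ fxs loo lg.
have [b [a [e [t [b0 ut Ew]]]]] := step_rank1 uv voo vw.
have [b' [a' [e' [t' [b'0 ut' Ew']]]]] := step_rank1 uv voo vw'.
have uu := face_refl u.
exists (K * (b * b'))%N.
exists (fun i => if i is i'.+1 then n i' * (b * b') else a * b')%N.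
exists (fun i => if i is i'.+1 then m i' * (b * b') else a' * b)%N.
exists (u *+ (e * b') + t' *+ b), (u *+ (e' * b) + t *+ b'); split.
- by rewrite !muln_gt0 K0 b0.
- by apply/faceD; split; apply: faceMn.
- by apply/faceD; split; apply: faceMn.
rewrite !lin_cons !linMn mulrnA.
have F1 : w *+ (b * b') + t *+ b' = v *+ (a * b') + u *+ (e * b').
  by rewrite !mulrnA -!mulrnDl Ew.
have F2 : w' *+ (b * b') + t' *+ b = v *+ (a' * b) + u *+ (e' * b).
  by rewrite [(b * b')%N]mulnC !mulrnA -!mulrnDl Ew'.
have F3 := congr1 (fun z => z *+ (b * b')) E; rewrite /= !mulrnDl in F3.
transitivity (g *+ K *+ (b * b') + lin xs n *+ (b * b') +
    (v *+ (a * b') + u *+ (e * b')) + t' *+ b).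
  by rewrite [RHS](AC (2*2*1) (1*(3*2)*(4*5))).
rewrite -F1 addrA F3.
rewrite [LHS](AC 4 (1*(2*4)*3)) /= F2.
by rewrite [LHS](AC (1*2*1) (2*1*(3*4))).
Qed.

End Faces.

(** * Counting elements with bounded coefficients *)

Lemma lin_sum (V : nmodType) (ys : seq V) n (f : nat -> nat -> nat) :
  lin ys (fun j => \sum_(i < n) f i j)%N = \sum_(i < n) lin ys (f i).
Proof. by rewrite /lin exchange_big; apply: eq_bigr => j _; rewrite sumrMnr. Qed.

Section Growth.
Variables (N : nmodType) (oo : N).
Hypothesis addoo : forall a : N, a + oo = oo.
Hypothesis addIoo : forall a b c : N, a + b = a + c -> a + b <> oo -> b = c.
Hypothesis redoo : forall (a : N) k, (0 < k)%N -> a *+ k = oo -> a = oo.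
Hypothesis unit_torsion : forall a b : N, a + b = 0 -> exists2 k, (0 < k)%N & a *+ k = 0.
Variable G : seq N.
Hypothesis spanG : forall x, span G x.

Lemma mulrn_neq_oo (a : N) k : (0 < k)%N -> a <> oo -> a *+ k <> oo.
Proof. by move=> k0 aoo /redoo-/(_ k0). Qed.

(** Pairs of coefficient vectors whose values agree after some multiplication admit subtraction
    while the value is finite. The product of the exponents of finitely many generating pairs serves
    all of them. *)
Lemma torsion_exponent : exists2 K, (0 < K)%N & forall c c' k, (0 < k)%N ->
  lin G c <> oo -> lin G c *+ k = lin G c' *+ k -> lin G c *+ K = lin G c' *+ K.
Proof.
pose R u := lin G (fun i => u (size G + i)%N).
pose P u := exists2 k, (0 < k)%N & lin G u *+ k = R u *+ k.
have [u []//|u v [[k k0 uk] uoo] [l l0 vl] vu|H [HP HI]] :=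
    @subtractive_ind (size G + size G) P (fun u => P u /\ lin G u <> oo).
  have Lu : lin G u = lin G v + lin G (fun i => u i - v i)%N.
    by apply: lin_subK => i iG; rewrite vu ?ltn_addr.
  have Ru : R u = R v + R (fun i => u i - v i)%N.
    by apply: lin_subK => i iG; rewrite vu ?ltn_add2l.
  split; last by move: uoo; rewrite Lu addrC; apply: addoo_l.
  have kl0 : (0 < k * l)%N by rewrite muln_gt0 k0.
  exists (k * l)%N => //; apply: (addIoo (a := lin G v *+ (k * l))); last first.
    by rewrite -mulrnDl -Lu; apply: mulrn_neq_oo.
  rewrite -mulrnDl -Lu mulrnA uk -mulrnA Ru mulrnDl; congr (_ + _).
  by rewrite mulnC !mulrnA vl.
have [K K0 HK] : exists2 K, (0 < K)%N & forall h, h \in H -> lin G h *+ K = R h *+ K.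
  elim: H HP {HI} => [|h H IH] HP; first by exists 1%N.
  have [|K K0 HK] := IH; first by move=> h' h'H; apply: HP; rewrite inE h'H orbT.
  have [|k k0 hk] := HP h; first by rewrite inE eqxx.
  exists (k * K)%N; first by rewrite muln_gt0 k0.
  move=> h'; rewrite inE => /orP[/eqP->|/HK h'K]; first by rewrite !mulrnA hk.
  by rewrite mulnC !mulrnA h'K.
exists K => // c c' k k0 coo ck.
pose u i := if (i < size G)%N then c i else c' (i - size G)%N.
have uL : lin G u = lin G c by apply: eq_lin => i iG; rewrite /u iG.
have uR : R u = lin G c'.
  by apply: eq_lin => i iG; rewrite /u ltnNge leq_addr addKn.
rewrite -uL -uR; apply: (HI (fun u => lin G u *+ K = R u *+ K)).
- move=> w w0; rewrite /R !lin0 // => i iG; apply: w0; first by rewrite ltn_add2l.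
  exact: ltn_addr.
- move=> w v [_ woo] vH vw IH.
  have -> : lin G w = lin G v + lin G (fun i => w i - v i)%N.
    by apply: lin_subK => i iG; rewrite vw ?ltn_addr.
  have -> : R w = R v + R (fun i => w i - v i)%N.
    by apply: lin_subK => i iG; rewrite vw ?ltn_add2l.
  by rewrite !mulrnDl HK // IH.
- by rewrite uL; split=> //; exists k; rewrite ?uL ?uR.
Qed.

(** The face of 0 consists of units; these have finite order, so a further multiple removes the
    error terms of [flag_coords]. *)
Lemma flag0_coords xs g : flag 0 xs -> last 0 xs <> oo -> face (last 0 xs) g ->
  exists K n m, (0 < K)%N /\ g *+ K + lin xs n = lin xs m.
Proof.
have unit0 (w : N) : face 0 w -> exists2 k, (0 < k)%N & w *+ k = 0.
  by move=> [k [z]]; rewrite mul0rn => /esym; apply: unit_torsion.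
move=> fxs loo lg.
have [K [n [m [w [w' [K0 /unit0[k k0 wk] /unit0[k' k'0 wk'] E]]]]]] :=
  flag_coords addoo addIoo redoo spanG fxs loo lg.
exists (K * (k * k'))%N, (fun i => n i * (k * k'))%N, (fun i => m i * (k * k'))%N.
split; first by rewrite !muln_gt0 K0 k0.
have wkk : w *+ (k * k') = 0 by rewrite mulrnA wk mul0rn.
have wkk' : w' *+ (k * k') = 0 by rewrite mulnC mulrnA wk' mul0rn.
have := congr1 (fun z => z *+ (k * k')) E.
by rewrite /= !mulrnDl wkk wkk' !addr0 !linMn (mulrnA g).
Qed.

(** One exponent [K] for all generators makes the coordinates linear in [c], so that a bound on [c]
    bounds them. *)
Lemma flag0_coords_lin xs : flag 0 xs -> last 0 xs <> oo ->
  exists K n m, (0 < K)%N /\ forall c, face (last 0 xs) (lin G c) ->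
    lin G c *+ K + lin xs (fun j => \sum_(i < size G) c i * n i j)%N =
    lin xs (fun j => \sum_(i < size G) c i * m i j)%N.
Proof.
move=> fxs loo.
have /choice[k kP] i : exists k : nat * (nat -> nat) * (nat -> nat), (0 < k.1.1)%N /\
    (face (last 0 xs) G`_i -> G`_i *+ k.1.1 + lin xs k.1.2 = lin xs k.2).
  have [/(flag0_coords fxs loo)[K [n [m [K0 E]]]]|nf] := pselect (face (last 0 xs) G`_i).
    by exists (K, n, m).
  (* Dummy data for generators outside the face: their coefficient is 0 in any [lin G c] lying in
     the face. *)
  by exists (1%N, fun=> 0%N, fun=> 0%N).
pose K := (\prod_(i < size G) (k i).1.1)%N.
pose K' i := (K %/ (k i).1.1)%N.
have KE i : (i < size G)%N -> K = ((k i).1.1 * K' i)%N.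
  move=> iG; rewrite mulnC divnK // /K (bigD1 (Ordinal iG)) //=; exact: dvdn_mulr.
exists K, (fun i j => (k i).1.2 j * K' i)%N, (fun i j => (k i).2 j * K' i)%N.
split; first by rewrite /K prodn_gt0 // => i; have [] := kP i.
move=> c fc; rewrite (lin_sum xs _ (fun i j => c i * ((k i).1.2 j * K' i))%N).
rewrite (lin_sum xs _ (fun i j => c i * ((k i).2 j * K' i))%N) -sumrMnl -big_split; apply: eq_bigr => i _ /=.
have lE e : lin xs (fun j => c i * (e j * K' i))%N = lin xs e *+ (K' i * c i).
  by rewrite -linMn; apply: eq_lin => j _; rewrite mulnCA (mulnC (c i)).
rewrite !lE; have [ci|ci] := posnP (c i).
  by rewrite ci !muln0 !mulr0n mul0rn addr0.
have [_ <-] := kP i; last by move/face_lin: fc; apply.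
by rewrite mulrnDl -!mulrnA (KE i) // (mulnC (c i)) mulnA.
Qed.

(* The residues of [c] modulo a torsion exponent and the coordinates of [lin G c]
   along the flag determine [lin G c]. *)
Lemma flag_count xs B : flag 0 xs -> last 0 xs <> oo ->
  exists C, forall q s, (0 < q)%N -> uniq s ->
    (forall x, x \in s -> face (last 0 xs) x /\
      exists2 c, x = lin G c & forall i, (i < size G)%N -> (c i <= B * q)%N) ->
    (size s <= C * q ^ size xs)%N.
Proof.
move=> fxs loo.
have [[//|T] _ HT] := torsion_exponent.
have [K [n [m [K0 HK]]]] := flag0_coords_lin fxs loo.
pose nc (n : 'I_(size G) -> nat -> nat) (c : nat -> nat) j := (\sum_(i < size G) c i * n i j)%N.
pose D := (\sum_(j < size xs) \sum_(i < size G) B * (n i j + m i j))%N.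
exists (T.+1 ^ size G * (D.*2.+1) ^ size xs)%N => q s q0 us Ps.
have /choice[c cP] x : exists c : nat -> nat, x \in s ->
    x = lin G c /\ forall i, (i < size G)%N -> (c i <= B * q)%N.
  have [/Ps[_ [c xE cB]]|] := boolP (x \in s); first by exists c.
  by exists (fun=> 0%N).
have ncD x j : x \in s -> (j < size xs)%N -> (nc n (c x) j + nc m (c x) j <= D * q)%N.
  move=> xs' jxs; rewrite /nc /D -big_split (bigD1 (Ordinal jxs)) //= mulnDl.
  apply: leq_trans (leq_addr _ _); rewrite big_distrl; apply: leq_sum => i _ /=.
  rewrite -mulnDr mulnAC leq_mul2r; apply/orP; right.
  by have [_ ->] := cP _ xs'.
(* [T.+1] is the torsion exponent, and the offset [D * q] makes the coordinates m - n
   nonnegative. *)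
pose sig x : {ffun 'I_(size G) -> 'I_T.+1} * {ffun 'I_(size xs) -> 'I_(D * q).*2.+1} :=
  ([ffun i => inord (c x (nat_of_ord i) %% T.+1)],
   [ffun j => inord (D * q + nc m (c x) (nat_of_ord j) - nc n (c x) (nat_of_ord j))]).
have sig_inj : {in s &, injective sig}.
  move=> x y xs' ys'; case=> /ffunP s1 /ffunP s2.
  have [xE xB] := cP _ xs'; have [yE yB] := cP _ ys'.
  have cxy i : (i < size G)%N -> c x i = c y i %[mod T.+1].
    move=> iG; have := s1 (Ordinal iG); rewrite !ffunE => /(congr1 val) /=.
    by rewrite !inordK ?ltn_pmod.
  have nm j : (j < size xs)%N ->
      (nc m (c x) j + nc n (c y) j = nc m (c y) j + nc n (c x) j)%N.
    move=> jxs; have hx := ncD _ _ xs' jxs; have hy := ncD _ _ ys' jxs.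
    have := s2 (Ordinal jxs); rewrite !ffunE => /(congr1 val) /=.
    by rewrite !inordK; move: hx hy; clear; lia.
  have [fx _] := Ps _ xs'; have [fy _] := Ps _ ys'.
  have Kx := HK (c x); rewrite -xE in Kx; have {}Kx := Kx fx.
  have Ky := HK (c y); rewrite -yE in Ky; have {}Ky := Ky fy.
  rewrite -!/(nc _ _ _) in Kx Ky.
  have xoo : x <> oo := face_neq_oo addoo redoo loo fx.
  have flx e : face (last 0 xs) (lin xs e).
    by apply/face_lin => i ixs _; apply: flag_nth.
  have xKy : x *+ K = y *+ K.
    pose S := lin xs (nc n (c x)) + lin xs (nc n (c y)).
    have mn : lin xs (nc m (c x)) + lin xs (nc n (c y)) =
        lin xs (nc m (c y)) + lin xs (nc n (c x)).
      by rewrite -!linD; apply: eq_lin.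
    have E : x *+ K + S = y *+ K + S.
      by rewrite {1}/S addrA Kx mn -Ky -addrA [_ + lin xs (nc n (c x))]addrC.
    apply: (addIoo (a := S)); first by rewrite addrC E addrC.
    apply: (face_neq_oo addoo redoo loo).
    by do 2?[apply/faceD; split] => //; apply: faceMn.
  (* By the congruences, x and y are [lin G w] plus multiples by [T.+1]. Cancelling [lin G w *+ K]
     in [xKy] shows these multiples equal up to torsion, and the exponent [T.+1] makes them
     equal. *)
  pose w i := minn (c x i) (c y i).
  pose p z i := ((c z i - w i) %/ T.+1)%N.
  have wp z : z \in s -> (z = x \/ z = y) -> z = lin G w + lin G (p z) *+ T.+1.
    move=> zs zxy; have [zE _] := cP _ zs; rewrite [LHS]zE -linMn -linD.
    apply: eq_lin => i iG; rewrite /p divnK.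
      by rewrite subnKC // /w; case: zxy => ->; [apply: geq_minl | apply: geq_minr].
    have /eqP E := cxy i iG; have E' := E; rewrite eq_sym in E'.
    by rewrite /w; case: zxy => ->; case: (leqP (c x i) (c y i)) => [h|/ltnW h];
      rewrite ?subnn ?dvdn0 // -eqn_mod_dvd.
  have xwp := wp x xs' (or_introl erefl); have ywp := wp y ys' (or_intror erefl).
  have woo : lin G w *+ K <> oo.
    apply: mulrn_neq_oo => //.
    by apply: (addoo_l addoo (b := lin G (p x) *+ T.+1)); rewrite -xwp.
  rewrite xwp ywp; congr (_ + _); apply: (HT _ _ (T.+1 * K)%N).
  - by rewrite muln_gt0.
  - apply: (mulrn_oo addoo (k := T.+1)) => //.
    by apply: (addoo_l addoo (b := lin G w)); rewrite addrC -xwp.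
  - rewrite !mulrnA; apply: (addIoo (a := lin G w *+ K)).
      by rewrite -!mulrnDl -xwp -ywp.
    by rewrite -mulrnDl -xwp; apply: mulrn_neq_oo.
rewrite -(size_map sig) -(card_uniqP _); last by rewrite map_inj_in_uniq.
apply: leq_trans (max_card _) _; rewrite card_prod !card_ffun !card_ord.
rewrite -mulnA leq_mul2l -expnMn; apply/orP; right.
case: (size xs) => // l; rewrite leq_exp2r // mulSn -doubleMl.
by rewrite -add1n leq_add2r.
Qed.

End Growth.

(** * Existence of the limit *)

Lemma lin_box (V : nmodType) (G : seq V) B : exists l : seq V,
  forall e, (forall i, (i < size G)%N -> (e i <= B)%N) -> lin G e \in l.
Proof.
pose ext (c : {ffun 'I_(size G) -> 'I_B.+1}) i :=
  if insub i is Some j then nat_of_ord (c j) else 0%N.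
exists [seq lin G (ext c) | c <- enum {ffun 'I_(size G) -> 'I_B.+1}] => e eB.
apply/mapP; exists [ffun i => inord (e (nat_of_ord i))]; rewrite ?mem_enum //.
by apply: eq_lin => i iG; rewrite /ext insubT ffunE inordK // ltnS eB.
Qed.

Section Limit.
Variables (N : nmodType) (oo : N).
Hypothesis addoo : forall a : N, a + oo = oo.
Hypothesis addIoo : forall a b c : N, a + b = a + c -> a + b <> oo -> b = c.
Hypothesis redoo : forall (a : N) k, (0 < k)%N -> a *+ k = oo -> a = oo.
Hypothesis unit_torsion : forall a b : N, a + b = 0 -> exists2 k, (0 < k)%N & a *+ k = 0.
Variable G : seq N.
Hypothesis spanG : forall x, span G x.
Variable d : nat.
Hypothesis flag_le : forall xs, flag 0 xs -> last 0 xs <> oo -> (size xs <= d)%N.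

(** A finite x lies in the face of the sum of the generators occurring in it. There are finitely
    many such sums, and [flag_count] applies to a flag ending in the face of each finite one. *)
Lemma growth B : exists C, forall q s, (0 < q)%N -> uniq s ->
  (forall x, x \in s -> x <> oo /\
    exists2 c, x = lin G c & forall i, (i < size G)%N -> (c i <= B * q)%N) ->
  (size s <= C * q ^ d)%N.
Proof.
have [l lP] := lin_box G 1.
have [C CP] : exists C, forall q s, (0 < q)%N -> uniq s ->
    (forall x, x \in s -> (exists x0, [/\ x0 \in l, x0 <> oo & face x0 x]) /\
      exists2 c, x = lin G c & forall i, (i < size G)%N -> (c i <= B * q)%N) ->
    (size s <= C * q ^ d)%N.
  elim: l {lP} => [|x0 l [C CP]].
    by exists 0%N => q [|x s] // _ _ /(_ x (mem_head _ _))[[x0 []]].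
  have [C0 C0P] : exists C0, forall q s, (0 < q)%N -> uniq s ->
      (forall x, x \in s -> (x0 <> oo /\ face x0 x) /\
        exists2 c, x = lin G c & forall i, (i < size G)%N -> (c i <= B * q)%N) ->
      (size s <= C0 * q ^ d)%N.
    have [->|x0oo] := pselect (x0 = oo).
      by exists 0%N => q [|x s] // _ _ /(_ x (mem_head _ _))[[]].
    have [xs [fxs xl lx]] := flag_exists spanG (face0 x0).
    have loo : last 0 xs <> oo := face_neq_oo addoo redoo x0oo xl.
    have [C0 C0P] := flag_count addoo addIoo redoo unit_torsion spanG B fxs loo.
    exists C0 => q s q0 us Ps; apply: leq_trans (C0P q s q0 us _) _.
      by move=> x /Ps[[_ fx] cx]; split=> //; apply: face_trans lx fx.
    by rewrite leq_mul2l leq_pexp2l ?orbT ?flag_le.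
  exists (C0 + C)%N => q s q0 us Ps.
  pose p x := `[< x0 <> oo /\ face x0 x >].
  rewrite -(count_predC p) -!size_filter mulnDl leq_add //.
    apply: C0P => [||x]; rewrite ?filter_uniq // mem_filter.
    by move=> /andP[/asboolP px /Ps[]].
  apply: CP => [||x]; rewrite ?filter_uniq // mem_filter.
  move=> /andP[/= /asboolP npx /Ps[[y [yl yoo yx]] cx]]; split=> //; move: yl.
  by rewrite inE => /orP[/eqP yE|yl]; [case: npx; rewrite -yE | exists y].
exists C => q s q0 us Ps; apply: CP => // x /Ps[xoo cx]; split=> //.
have [c xE _] := cx.
exists (lin G (fun i => minn (c i) 1)); split.
- by apply: lP => i _; apply: geq_minr.
- move=> E; apply: xoo.
  rewrite xE (lin_subK (e' := fun i => minn (c i) 1)) => [|i _]; last exact: geq_minl.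
  by rewrite E addrC addoo.
- rewrite xE; apply/face_lin => i iG ci.
  have := face_refl (lin G (fun i => minn (c i) 1)).
  by move=> /face_lin/(_ i iG); apply; rewrite leq_min ci.
Qed.

Lemma hilbert_kunz_limit (A : seq N) (B : nat) : A != [::] ->
  (forall q x, (0 < q)%N -> (forall a, a \in A -> ~ exists t, x = a *+ q + t) ->
     exists2 c, x = lin G c & forall i, (i < size G)%N -> (c i <= B * q)%N) ->
  exists2 f : nat -> nat, (forall q, (0 < q)%N ->
      has_card (fun x => forall a, a \in A -> ~ exists t, x = a *+ q + t) (f q)) &
    exists r, tends (fun q => (f q)%:R / q%:R ^+ d) r.
Proof.
move=> A0 AB; have [l lP] := lin_box G B.
have [|f fP Qf] := quasi_poly_sieve addoo addIoo spanG A (ys := [seq (x, 1%N) | x <- l]).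
  by apply/allP => _ /mapP[x _ ->].
(* A vector bounded by [B * q] is a sum of q vectors bounded by [B], each of which contributes an
   element of degree 1. *)
have spanE q c : (forall i, (i < size G)%N -> (c i <= B * q)%N) ->
    span [seq (x, 1%N) | x <- l] (lin G c, q).
  elim: q c => [|q IHq] c cB.
    rewrite lin0 => [|i /cB]; first exact: span0.
    by rewrite muln0 leqn0 => /eqP.
  have -> : (lin G c, q.+1) =
      (lin G (fun i => minn (c i) B), 1%N) + (lin G (fun i => c i - minn (c i) B)%N, q).
    rewrite (lin_subK (e' := fun i => minn (c i) B)) => [|i _]; last exact: geq_minl.
    by congr (_, _).
  apply: spanD.
    by apply: span_mem; rewrite map_f // lP // => i _; apply: geq_minr.
  by apply: IHq => i /cB; rewrite mulnS; clear; lia.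
have neq_oo q x : (forall a, a \in A -> ~ exists t, x = a *+ q + t) -> x <> oo.
  case: A A0 {AB f fP Qf} => // a A _ nA xoo; apply: (nA a); first exact: mem_head.
  by exists oo; rewrite xoo addoo.
have fP' q : (0 < q)%N ->
    has_card (fun x => forall a, a \in A -> ~ exists t, x = a *+ q + t) (f q).
  move=> q0; apply: eq_has_card (fP q) => x; split=> [[_ []]//|nA].
  by split; [apply: neq_oo nA | split=> //; have [c -> /spanE] := AB _ _ q0 nA].
exists f => //; have [C CP] := growth B.
apply: (quasi_poly_limit (C := C%:R) Qf).
  move=> p q; rewrite -!topredE /= => p0 q0 pq; rewrite ler_nat.
  have [s [us <- Ps]] := fP' p p0; have [s' [us' <- Ps']] := fP' q q0.
  apply: uniq_leq_size => // x /Ps nA; apply/Ps' => a aA [t xE]; apply: (nA a aA).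
  by exists (a *+ (q - p) + t); rewrite addrA -mulrnDr subnKC.
move=> q q0; rewrite ler0n -natrX -natrM ler_nat.
have [s [us <- Ps]] := fP' q q0; apply: CP => // x /Ps nA.
by split; [apply: neq_oo nA | apply: AB].
Qed.

End Limit.

(** * Binoids *)

HB.instance Definition _ (N : binoid) := gen_eqMixin (bcar N).
HB.instance Definition _ (N : binoid) := gen_choiceMixin (bcar N).
HB.instance Definition _ (N : binoid) :=
  GRing.isNmodule.Build (bcar N) (@baddA N) (@baddC N) (@badd0 N).

Lemma In_mem (T : eqType) (x : T) s : List.In x s <-> x \in s.
Proof.
elim: s => //= y s IHs; rewrite inE; split=> [[->|/IHs->]|/orP[/eqP->|/IHs]].
- by rewrite eqxx.
- by rewrite orbT.
- by left.
- by right.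
Qed.

Lemma NoDup_uniq (T : eqType) (s : seq T) : List.NoDup s <-> uniq s.
Proof.
split; first by elim=> //= x l xl _ ->; rewrite andbT; apply/negP => /In_mem.
elim: s => [_|x s IHs /= /andP[xs /IHs us]]; constructor=> //.
by move=> /In_mem; apply/negP.
Qed.

Section Binoid.
Variable N : binoid.
Implicit Types a b x : N.

Lemma bnsmulE k a : bnsmul k a = a *+ k.
Proof. by elim: k => [|k IHk] //=; rewrite IHk mulrS. Qed.

Lemma card_isE (P : N -> Prop) k : card_is P k <-> has_card P k.
Proof.
split=> -[s [us [Ps sk]]]; exists s.
  by split=> // [|x]; [apply/NoDup_uniq | rewrite Ps In_mem].
split; first exact/NoDup_uniq.
by split=> [x|]; rewrite ?In_mem.
Qed.

Lemma addr_binf a : a + binf N = binf N.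
Proof. exact: baddI. Qed.

Lemma finitely_generated_span : finitely_generated N -> exists G : seq N, forall x, span G x.
Proof.
move=> [G GP]; exists G => x; elim: (GP x) => [|g y /In_mem gG _ yG].
  exact: span0.
by apply: spanD => //; apply: span_mem.
Qed.

Lemma reduced_mulrn : reduced N -> forall a k, (0 < k)%N -> a *+ k = binf N -> a = binf N.
Proof. by move=> redN a k k0 ak; apply: redN; exists k; rewrite bnsmulE. Qed.

Lemma semipositive_torsion : semipositive N ->
  forall a b, a + b = 0 -> exists2 k, (0 < k)%N & a *+ k = 0.
Proof.
move=> [_ [l lP]] a b ab.
have multl k : a *+ k \in l.
  by apply/In_mem/lP; exists (b *+ k); rewrite -[badd _ _]/(_ + _) -mulrnDl ab mul0rn.
have /(uniqPn 0)[i [j [ij]]] : ~~ uniq [seq a *+ k | k <- iota 0 (size l).+1].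
  apply/negP => us; have := uniq_leq_size us (s2 := l).
  rewrite size_map size_iota ltnn => F; apply: notF; apply: F => _ /mapP[k _ ->].
  exact: multl.
rewrite size_map size_iota => jl.
rewrite !(nth_map 0%N) ?size_iota ?(ltn_trans ij) // !nth_iota ?(ltn_trans ij) // !add0n.
move=> E; exists (j - i)%N; first by rewrite subn_gt0.
have := congr1 (fun z => z + b *+ i) E; rewrite /= -mulrnDl ab mul0rn.
have -> : a *+ j = a *+ (j - i) + a *+ i by rewrite -mulrnDr subnK // ltnW.
by rewrite -addrA -mulrnDl ab mul0rn addr0.
Qed.

Lemma ideal_addl (I : N -> Prop) a b : ideal I -> I a -> I (a + b).
Proof. by move=> [_ ID] Ia; apply: ID. Qed.

Lemma ideal_Mn (I : N -> Prop) a k : ideal I -> (0 < k)%N -> I a -> I (a *+ k).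
Proof. by case: k => // k hI _ Ia; rewrite mulrS; apply: ideal_addl. Qed.

Lemma prime_ideal0 (P : N -> Prop) : prime_ideal P -> ~ P 0.
Proof. by move=> [hP [[x nPx] _]] P0; apply: nPx; rewrite -[x]add0r; apply: ideal_addl. Qed.

Lemma prime_ideal_lin (P : N -> Prop) (G : seq N) e : prime_ideal P -> P (lin G e) ->
  exists i, [/\ (i < size G)%N, (0 < e i)%N & P G`_i].
Proof.
move=> hP; have [_ [_ Pprime]] := hP.
elim: G e => [|g G IHG] e; first by rewrite lin_nil => /(prime_ideal0 hP).
rewrite lin_cons => /Pprime[|/IHG[i [iG ei Pi]]]; last by exists i.+1.
case e0: (e 0%N) => [|k]; first by rewrite mulr0n => /(prime_ideal0 hP).
move=> Pg; exists 0%N; rewrite e0; split=> //=.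
elim: k Pg {e0} => [|k IHk]; first by rewrite mulr1n.
by rewrite mulrS => /Pprime[|/IHk].
Qed.

Section Generators.
Variable G : seq N.
Hypothesis spanG : forall x, span G x.

(** A prime containing a sum of generators contains one of them, so each strict inclusion of primes
    adds a generator. This makes the dimension finite. *)
Lemma prime_chain_le k p : prime_chain (N := N) k p -> (k <= size G)%N.
Proof.
move=> [pP pS]; pose c i := count (fun g => `[< p i g >]) G.
suff ic i : (i <= k)%N -> (i <= c i)%N by apply: leq_trans (ic k (leqnn k)) (count_size _ _).
elim: i => // i IHi ik; apply: leq_ltn_trans (IHi (ltnW ik)) _.
have [sub [x [px npx]]] := pS i ik.
have [e xE] := spanG x; rewrite xE in px npx.
have [j [jG ej pj]] := prime_ideal_lin (pP _ ik) px.
have npj : ~ p i G`_j.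
  move=> pij; apply: npx.
  have -> : lin G e = G`_j + lin G (fun l => e l - (l == j))%N.
    rewrite -(lin_delta jG); apply: lin_subK => l lG.
    by case: eqP => // ->.
  by apply: ideal_addl pij; have [] := pP i (ltnW ik).
rewrite /c !(permP (perm_to_rem (mem_nth 0 jG))) /=.
rewrite (asboolT pj) (asboolF npj) add0n add1n ltnS; apply: sub_count => h.
by move=> /asboolP ph; apply/asboolP/sub.
Qed.

Hypothesis redN : reduced N.

Lemma face_prime x : x <> binf N -> prime_ideal (fun y => ~ face x y).
Proof.
have redoo := reduced_mulrn redN.
move=> xoo; split; [split|split].
- exists (binf N) => /(face_neq_oo addr_binf redoo xoo); exact.
- by move=> a b na /faceD[].
- by exists 0 => nf; apply: nf; apply: face0.
- by move=> a b nab; apply/not_andP => -[fa fb]; apply: nab; apply/faceD.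
Qed.

Lemma flag_step (u : N) xs j : flag u xs -> (j < size xs)%N ->
  step (nth 0 (u :: xs) j) (nth 0 (u :: xs) j.+1).
Proof.
elim: xs u j => // v xs IHxs u [|j] /= [uv fxs] jxs //.
exact: (IHxs v j).
Qed.

Lemma flag_prime_chain xs : flag 0 xs -> last 0 xs <> binf N ->
  exists p, prime_chain (N := N) (size xs) p.
Proof.
move=> fxs loo; pose X j := nth 0 (0 :: xs) j.
(* The index runs backwards since complements reverse inclusions. *)
exists (fun i y => ~ face (X (size xs - i)%N) y); split=> i ik.
  apply: face_prime; rewrite /X; case: (size xs - i)%N (leq_subr i (size xs)) => [|j] jxs.
    exact: (face_neq_oo addr_binf (reduced_mulrn redN) loo (face0 _)).
  exact: (face_neq_oo addr_binf (reduced_mulrn redN) loo (flag_nth fxs jxs)).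
have [|ji nij _] := @flag_step 0 xs (size xs - i.+1) fxs.
  by rewrite ltn_subrL (leq_ltn_trans _ ik).
rewrite subnSK // in ji nij; split.
  by move=> y nf fy; apply: nf; apply: face_trans ji fy.
by exists (X (size xs - i)%N); split=> // nf; apply: nf; apply: face_refl.
Qed.

Lemma ideal_finite_basis (I : N -> Prop) : ideal I -> exists A : seq N,
  (forall a, a \in A -> I a) /\ forall x, I x -> exists2 a, a \in A & exists t, x = a + t.
Proof.
move=> hI; have [l [lI domin]] := dickson (size G) (fun e => I (lin G e)).
exists [seq lin G v | v <- l]; split=> [_ /mapP[v /lI Iv ->] //|x Ix].
have [e xE] := spanG x; have [|v vl ve] := domin e; first by rewrite -xE.
by exists (lin G v); [exact: map_f | exists (lin G (fun i => e i - v i)%N); rewrite xE -lin_subK].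
Qed.

(** A unit generator has finite order and a nonunit has a multiple in [n]; the product of these
    exponents serves all generators. *)
Lemma primary_exponent (n : N -> Prop) : semipositive N -> Nplus_primary n ->
  exists2 B, (0 < B)%N & forall g, g \in G -> g *+ B = 0 \/ n (g *+ B).
Proof.
move=> sN [nI [_ nP]]; elim: G => [|g l [B B0 BP]]; first by exists 1%N.
have [k k0 kP] : exists2 k, (0 < k)%N & g *+ k = 0 \/ n (g *+ k).
  have [[b gb]|/nP[k [k0 nk]]] := pselect (is_unit g).
    by have [k k0 gk] := semipositive_torsion sN gb; exists k => //; left.
  by exists k => //; right; rewrite -bnsmulE.
exists (k * B)%N; first by rewrite muln_gt0 k0.
move=> h; rewrite inE => /orP[/eqP->|/BP[hB|hB]].
- by rewrite mulrnA; case: kP => [->|/(ideal_Mn nI B0)]; [left; rewrite mul0rn | right].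
- by left; rewrite mulnC mulrnA hB mul0rn.
- by right; rewrite mulnC mulrnA; apply: ideal_Mn.
Qed.

Lemma qidealE (n : N -> Prop) (A : seq N) q x : ideal n -> (forall a, a \in A -> n a) ->
  (forall x, n x -> exists2 a, a \in A & exists t, x = a + t) ->
  ~ sumset (qideal q n) x <-> forall a, a \in A -> ~ exists t, x = a *+ q + t.
Proof.
move=> nI An nA; split=> [nx a aA [t xE]|nx [z [t [[a [b [na zE]]] xE]]]].
  apply: nx; exists (a *+ q), t; split=> //; exists a, 0; split; first exact: An.
  by rewrite bnsmulE -[RHS]/(_ + 0) addr0.
have [a' a'A [s aE]] := nA _ na; apply: (nx a' a'A).
exists (s *+ q + b + t); rewrite xE zE bnsmulE aE mulrnDl.
by rewrite -[LHS]/(_ + _ + _ + _) !addrA.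
Qed.

End Generators.
End Binoid.

Theorem mainTheorem1 (N : binoid) (n : N -> Prop) :
  finitely_generated N -> semipositive N -> cancellative N -> reduced N ->
  Nplus_primary n ->
  exists d : nat, is_dim N d /\
    (forall q : nat, (0 < q)%N -> exists k, HKF_is n q k) /\
    exists r : rat,
      forall eps : rat, (0 < eps)%R ->
        exists Q : nat, forall q k : nat, (0 < q)%N -> (Q <= q)%N ->
          HKF_is n q k ->
          (`| (k%:R / (q%:R ^+ d)) - r | < eps)%R.
Proof.
move=> /finitely_generated_span[G spanG] sN cN rN nP.
have [nI _] := nP; have redoo := reduced_mulrn rN.
have zero_neq_oo : (0 : N) <> binf N.
  move=> E; have [[x xoo] _] := sN; apply: xoo.
  by rewrite -[x]addr0 E addr_binf.
have exd : exists d, `[< exists p, prime_chain (N := N) d p >].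
  by exists 0%N; apply/asboolP; apply: (@flag_prime_chain N rN [::]).
have dim_le k : `[< exists p, prime_chain (N := N) k p >] -> (k <= size G)%N.
  by move=> /asboolP[p]; apply: prime_chain_le.
have [d /asboolP dP dmax] := ex_maxnP exd dim_le.
exists d; split; first by split=> // k p kp; apply: dmax; apply/asboolP; exists p.
have flag_le xs : flag 0 xs -> last 0 xs <> binf N -> (size xs <= d)%N.
  by move=> fxs loo; apply: dmax; apply/asboolP; apply: flag_prime_chain.
have [A [An nA]] := ideal_finite_basis spanG nI.
have [B B0 BP] := primary_exponent G sN nP.
have A0 : A != [::].
  have [[x /nA[a aA _]] _] := nI; by apply: contraTneq aA => ->.
have AB q x : (0 < q)%N -> (forall a, a \in A -> ~ exists t, x = a *+ q + t) ->
    exists2 c, x = lin G c & forall i, (i < size G)%N -> (c i <= B * q)%N.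
  move=> q0 nx; have [c xE] := spanG x.
  (* Coefficients of generators with [B]-th multiple 0 are reduced modulo [B]; the others are
     bounded because x lies outside [q]n. *)
  exists (fun i => if G`_i *+ B == 0 then (c i %% B)%N else c i).
    rewrite xE; apply: eq_bigr => i _; case: eqP => // iB.
    by rewrite {1}(divn_eq (c i) B) mulrnDr mulnC mulrnA iB mul0rn add0r.
  move=> i iG; case: eqP => [_|nB].
    by rewrite (leq_trans (ltnW (ltn_pmod _ B0))) // leq_pmulr.
  rewrite leqNgt; apply/negP => lt.
  have [//|/nA[a aA [t aE]]] := BP _ (mem_nth 0 iG).
  apply: (nx a aA); exists (t *+ q + lin G (fun j => c j - (j == i) * (B * q))%N).
  rewrite addrA -mulrnDl -aE -mulrnA -(lin_delta iG) -linMn xE.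
  by apply: lin_subK => j jG; case: eqP => [->|]; rewrite ?mul1n // ltnW.
have [f fP [r fr]] := hilbert_kunz_limit (@addr_binf N) cN redoo (semipositive_torsion sN)
  spanG flag_le A0 AB.
have HK q k : (0 < q)%N -> HKF_is n q k <-> k = f q.
  move=> q0; rewrite /HKF_is card_isE; split=> [kP|->].
    by apply: has_card_uniq (fP q q0); apply: eq_has_card kP => x; apply: qidealE.
  by apply: eq_has_card (fP q q0) => x; symmetry; apply: qidealE.
split; first by move=> q q0; exists (f q); apply/HK.
exists r => eps /fr[Q QP]; exists Q => q k q0 Qq /HK -> //; exact: QP.
Qed.
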